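(* Let $\varrho\in(0,1]$, $r\ge 2$, $L\ge 0$, $T>0$. For $n\in\mathbb{N}$ and a discretization $0=t_0<t_1<\dots<t_n=T$ put $\Delta t_i=t_{i+1}-t_i$ and $$\mathcal{A}^{RM}_n(\tilde X,\tilde W)=\sum_{i=0}^{n-1}\tilde X(t_i)\,(\tilde W(t_{i+1})-\tilde W(t_i)).$$ (i) Let $s\ge 0$ and $q\in(r,+\infty)$. There exists a positive constant $C$, depending only on $r,q,L,\varrho,T$ and $s$, such that for all $n\in\mathbb{N}$, all discretizations $0=t_0<\dots<t_n=T$, all $\delta_1,\delta_2\ge 0$, $X\in F^{\varrho,r,q}_L$ and $(\tilde X,\tilde W)\in V_X(\delta_1)\times\mathcal{W}_s(\delta_2)$, $$\|\mathcal{I}(X,W)-\mathcal{A}^{RM}_n(\tilde X,\tilde W)\|_r\le C\Bigl(\max_{0\le i\le n-1}(\Delta t_i)^{\varrho}+\delta_1+\delta_2+\delta_1\delta_2\Bigr).$$ (ii) Let $s\ge 0$ and $q\in(r,+\infty)$. There exists a positive constant $C$, depending only on $r,q,L,\varrho,T$ and $s$, such that for all $n\in\mathbb{N}$, all discretizations $0=t_0<\dots<t_n=T$, all $\delta_1,\delta_2\ge 0$, $X\in F^{\varrho,r,q}_L$ and $(\tilde X,\tilde W)\in V_X(\delta_1)\times\mathcal{\bar W}_s(\delta_2)$, $$\|\mathcal{I}(X,W)-\mathcal{A}^{RM}_n(\tilde X,\tilde W)\|_r\le C\Bigl(\max_{0\le i\le n-1}(\Delta t_i)^{\varrho}+\delta_1+\delta_2(1+\delta_1)\Bigl(1+\sum_{i=0}^{n-1}(\Delta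 t_i)^{1/2}\Bigr)\Bigr).$$ (iii) Let $\alpha,\beta\in(0,1]$ and $q\in[r,+\infty)$. There exists a positive constant $C$, depending only on $r,q,L,\varrho,T$ and $\alpha,\beta$, such that for all $n\in\mathbb{N}$, all discretizations $0=t_0<\dots<t_n=T$, all $\delta_1,\delta_2\ge 0$, $X\in F^{\varrho,r,q}_L$ and $(\tilde X,\tilde W)\in V_X(\delta_1)\times\mathcal{W}_{\alpha,\beta}(\delta_2)$, $$\|\mathcal{I}(X,W)-\mathcal{A}^{RM}_n(\tilde X,\tilde W)\|_r\le C\Bigl(\max_{0\le i\le n-1}(\Delta t_i)^{\varrho}+\delta_1+\delta_2(1+\delta_1)\sum_{i=0}^{n-1}\bigl((\Delta t_i)^{\alpha}+(\Delta t_i)^{\beta/2}\bigr)\Bigr).$$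
   Context: $W=\{W(t)\}_{t\ge0}$ is a standard one-dimensional Wiener process on a complete probability space $(\Omega,\Sigma,\mathbb{P})$ with respect to a filtration $\{\Sigma_t\}_{t\ge0}$ satisfying the usual conditions. For a real random variable $Y$, $\|Y\|_q=(\mathbb{E}|Y|^q)^{1/q}$. $\mathcal{I}(X,W)=\int_0^T X(t)\,dW(t)$ is the It\^o integral. Integrands: for $r,q\in[2,+\infty)$, $q\ge r$, $L\ge0$, $\varrho\in(0,1]$, $F^{\varrho,r,q}_L$ is the class of all $\{\Sigma_t\}$-progressively measurable processes $X:[0,T]\times\Omega\to\mathbb{R}$ such that $\bigl\|\sup_{t\in[0,T]}|X(t)|\bigr\|_q\le L$ and $\|X(t)-X(z)\|_r\le L|t-z|^{\varrho}$ for all $t,z\in[0,T]$. Disturbing functions $p:[0,T]\times\mathbb{R}\to\mathbb{R}$ (with the convention $|y|^s:=0$ for all $y$ if $s=0$): - $\mathcal{K}^1$: $p$ Borel measurable with $|p(t,y)|\le 1+|y|$ for all $t,y$. - $\mathcal{K}^2_s$, $s\ge0$: $p\in C^{1,2}([0,T]\times\mathbb{R})$ with $\max\{|\partial_t p(t,y)|,|\partial_y p(t,y)|,|\partial_y^2 p(t,y)|\}\le 1+|y|^s$ for all $t,y$. - $\mathcal{\bar K}^2_s$, $s\ge0$: $p\in C^{1,1}([0,T]\times\mathbb{R})$ (continuously differentiable once in each variable) with $\max\{|\partial_t p(t,y)|,|\partial_y p(t,y)|\}\le 1+|y|^s$ for all $t,y$. - $\mathcal{K}^3_{\alpha,\beta}$,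 $\alpha,\beta\in(0,1]$: $|p(t,x)-p(z,y)|\le|t-z|^{\alpha}+|x-y|^{\beta}$ for all $t,z\in[0,T]$, $x,y\in\mathbb{R}$. Noisy versions, for $\delta_1,\delta_2\ge0$: $V_X(\delta_1)$ is the set of processes $\tilde X$ of the form $\tilde X(t,\omega)=X(t,\omega)+\delta_1 p_X(t,X(t,\omega))$ for all $(t,\omega)\in[0,T]\times\Omega$, with some $p_X\in\mathcal{K}^1$. The sets $\mathcal{W}_s(\delta_2)$, $\mathcal{\bar W}_s(\delta_2)$, $\mathcal{W}_{\alpha,\beta}(\delta_2)$ consist of the processes $\tilde W$ of the form $\tilde W(t,\omega)=W(t,\omega)+\delta_2 p_W(t,W(t,\omega))$ for all $(t,\omega)\in[0,T]\times\Omega$, with some $p_W\in\mathcal{K}^2_s$, $p_W\in\mathcal{\bar K}^2_s$, $p_W\in\mathcal{K}^3_{\alpha,\beta}$, respectively. *)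

(* Defs.v *)
From HB Require Import structures.
From mathcomp Require Import all_boot all_order all_algebra.
From mathcomp Require Import all_classical all_reals all_analysis.
Import Order.TTheory GRing.Theory Num.Theory.
Import numFieldNormedType.Exports.

Set Implicit Arguments.
Unset Strict Implicit.
Unset Printing Implicit Defensive.

Local Open Scope classical_set_scope.
Local Open Scope ring_scope.

(* Processes are functions of (time, outcome) defined for every real time; only
   their values on [0, +oo[ (the Wiener process and the filtration) or on [0, T]
   (integrands, noisy versions) are ever constrained or used. *)

Definition sub_measurable d (Omega : measurableType d) (R : realType)
    (G : set (set Omega)) (Y : Omega -> R) : Prop :=
  forall B : set R, measurable B -> G (Y @^-1` B).

Definition filtration d (Omega : measurableType d) (R : realType)
    (F : R -> set (set Omega)) : Prop :=
  (forall t : R, 0 <= t -> sigma_algebra setT (F t) /\ F t `<=` measurable) /\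
  (forall s t : R, 0 <= s -> s <= t -> F s `<=` F t).

Definition usual_conditions d (Omega : measurableType d) (R : realType)
    (P : probability Omega R) (F : R -> set (set Omega)) : Prop :=
  P.-negligible `<=` F 0 /\
  (forall t : R, 0 <= t -> F t = \bigcap_(u in `]t, +oo[) F u).

(* normal_prob takes the standard deviation, not the variance. *)
Definition wiener_process d (Omega : measurableType d) (R : realType)
    (P : probability Omega R) (F : R -> set (set Omega))
    (W : R -> Omega -> R) : Prop :=
  [/\ {ae P, forall w, W 0 w = 0},
      {ae P, forall w, {within `[0, +oo[, continuous (W ^~ w)}},
      forall t : R, 0 <= t -> sub_measurable (F t) (W t),
      forall s t : R, 0 <= s -> s < t -> forall B : set R, measurable B ->
        P ((W t \- W s) @^-1` B) = normal_prob 0 (Num.sqrt (t - s)) B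
    & forall s t : R, 0 <= s -> s < t ->
        forall (A : set Omega) (B : set R), F s A -> measurable B ->
        P (A `&` (W t \- W s) @^-1` B) =
        (P A * P ((W t \- W s)%R @^-1` B))%E].

(* The trace of B(R) (x) F_t on [0, t] x Omega is B([0, t]) (x) F_t. *)
Definition progressively_measurable d (Omega : measurableType d)
    (R : realType) (F : R -> set (set Omega)) (T : R)
    (X : R -> Omega -> R) : Prop :=
  forall t : R, 0 <= t <= T ->
    measurable_fun (`[0, t] `*` setT)
      (fun z : R * g_sigma_algebraType (F t) => X z.1 z.2).

Definition discretization (R : realType) (T : R) (n : nat) (t : nat -> R) :
    Prop :=
  [/\ t 0%N = 0, t n = T & forall i, (i < n)%N -> t i < t i.+1].

Record elementary_process d (Omega : measurableType d) (R : realType)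
    (F : R -> set (set Omega)) (T : R) := ElementaryProcess {
  elem_size : nat;
  elem_time : nat -> R;
  elem_coef : nat -> Omega -> R;
  elem_timeP : discretization T elem_size elem_time;
  elem_coef_meas : forall i, (i < elem_size)%N ->
    sub_measurable (F (elem_time i)) (elem_coef i);
  elem_coef_bounded : exists M : R, forall i, (i < elem_size)%N ->
    forall w, `|elem_coef i w| <= M
}.

Definition elem_fun d (Omega : measurableType d) (R : realType)
    (F : R -> set (set Omega)) (T : R) (H : elementary_process F T)
    (t : R) (w : Omega) : R :=
  \sum_(i < elem_size H)
    elem_coef H i w * \1_(`]elem_time H i, elem_time H i.+1]) t.

Definition elem_integral d (Omega : measurableType d) (R : realType)
    (F : R -> set (set Omega)) (T : R) (W : R -> Omega -> R)
    (H : elementary_process F T) (w : Omega) : R :=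
  \sum_(i < elem_size H)
    elem_coef H i w * (W (elem_time H i.+1) w - W (elem_time H i) w).

(* I is (a version of) the Ito integral of X over [0, T]: the L^2(P)-limit of
   the integrals of elementary processes converging to X in
   L^2([0, T] x Omega).  The limit exists, and is unique up to P-null sets, for
   every progressively measurable X with E int_0^T X^2 dt < +oo. *)
Definition ito_integral d (Omega : measurableType d) (R : realType)
    (P : probability Omega R) (F : R -> set (set Omega)) (T : R)
    (W X : R -> Omega -> R) (I : Omega -> R) : Prop :=
  measurable_fun setT I /\
  exists H : nat -> elementary_process F T,
    ((fun k => \int[P]_w \int[lebesgue_measure]_(t in `[0%R, T])
        (((elem_fun (H k) t w - X t w) ^+ 2)%:E))%E @ \oo --> 0%E) /\
    ((fun k => \int[P]_w (((elem_integral W (H k) w - I w) ^+ 2)%:E))%E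
        @ \oo --> 0%E).

Definition integrand_class d (Omega : measurableType d) (R : realType)
    (P : probability Omega R) (F : R -> set (set Omega)) (T rho r q L : R) :
    set (R -> Omega -> R) :=
  [set X : R -> Omega -> R | [/\ progressively_measurable F T X,
    ('N[P]_(q%:E)[(fun w => ereal_sup [set `|X t w|%:E | t in `[0%R, T]])]
       <= L%:E)%E
  & forall t z : R, 0 <= t <= T -> 0 <= z <= T ->
    ('N[P]_(r%:E)[(fun w => (X t w - X z w)%:E)]
       <= (L * `|t - z| `^ rho)%:E)%E]].

(* |y|^s with the convention |y|^0 = 0 (powR has a `^ 0 = 1). *)
Definition abs_pow (R : realType) (y s : R) : R :=
  if s == 0 then 0 else `|y| `^ s.

(* One-sided at t = 0 and t = T. *)
Definition is_time_derivative (R : realType) (T : R) (p pt : R -> R -> R) :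
    Prop :=
  forall t y : R, 0 <= t <= T ->
    (p z y - p t y) / (z - t) @[z --> within `[0, T] (t^')] --> pt t y.

Definition is_space_derivative (R : realType) (T : R) (p py : R -> R -> R) :
    Prop :=
  forall t y : R, 0 <= t <= T -> is_derive y 1 (p t) (py t y).

Definition jointly_continuous (R : realType) (T : R) (p : R -> R -> R) : Prop :=
  {within `[0, T] `*` setT, continuous (fun z : R * R => p z.1 z.2)}.

Definition K1 (R : realType) (T : R) : set (R -> R -> R) :=
  [set p : R -> R -> R | measurable_fun (`[0, T] `*` setT) (fun z : R * R => p z.1 z.2) /\
    forall t y : R, 0 <= t <= T -> `|p t y| <= 1 + `|y|].

Definition K2 (R : realType) (T s : R) : set (R -> R -> R) :=
  [set p : R -> R -> R | exists pt py pyy : R -> R -> R,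
    [/\ is_time_derivative T p pt,
        is_space_derivative T p py,
        is_space_derivative T py pyy,
        [/\ jointly_continuous T p, jointly_continuous T pt,
            jointly_continuous T py & jointly_continuous T pyy]
      & forall t y : R, 0 <= t <= T ->
        Num.max (Num.max `|pt t y| `|py t y|) `|pyy t y| <= 1 + abs_pow y s]].

Definition K2bar (R : realType) (T s : R) : set (R -> R -> R) :=
  [set p : R -> R -> R | exists pt py : R -> R -> R,
    [/\ is_time_derivative T p pt,
        is_space_derivative T p py,
        [/\ jointly_continuous T p, jointly_continuous T pt
          & jointly_continuous T py]
      & forall t y : R, 0 <= t <= T ->
        Num.max `|pt t y| `|py t y| <= 1 + abs_pow y s]].

Definition K3 (R : realType) (T alpha beta : R) : set (R -> R -> R) :=
  [set p : R -> R -> R | forall t z x y : R, 0 <= t <= T -> 0 <= z <= T ->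
    `|p t x - p z y| <= `|t - z| `^ alpha + `|x - y| `^ beta].

(* The noisy versions of the process Y at level delta with disturbing functions
   in K: V_X(delta) is noisy T (K1 T) X delta, and W_s(delta), \bar W_s(delta)
   and W_{alpha,beta}(delta) are noisy T K W delta for K = K2 T s, K2bar T s and
   K3 T alpha beta. *)
Definition noisy (Omega : Type) (R : realType) (T : R) (K : set (R -> R -> R))
    (Y : R -> Omega -> R) (delta : R) : set (R -> Omega -> R) :=
  [set Yt : R -> Omega -> R | exists2 p, K p & forall (t : R) w, 0 <= t <= T ->
    Yt t w = Y t w + delta * p t (Y t w)].

Definition rm_quadrature (Omega : Type) (R : realType) (n : nat)
    (t : nat -> R) (Xt Wt : R -> Omega -> R) (w : Omega) : R :=
  \sum_(i < n) Xt (t i) w * (Wt (t i.+1) w - Wt (t i) w).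

Definition mesh_pow (R : realType) (n : nat) (t : nat -> R) (rho : R) : R :=
  \big[Num.max/0]_(i < n) (t i.+1 - t i) `^ rho.

(* Main.v *)
(** The whole argument is discrete.  Since Wiener increments are centered and
    independent of the past, expanding [|M + Y (W t - W s)|^r] to second order
    and a discrete Gronwall argument give, for adapted weights,
    [E|sum_j Y_j (W_(j+1) - W_j)|^r <= K sum_j (s_(j+1) - s_j) E|Y_j|^r]
    whenever [r >= 2]; this replaces the Burkholder and Ito inequalities.

    For [r = 2] it shows that the quadratures of [X] on common refinements of
    the given grid, of the grid of an approximating elementary process and of a
    fine uniform grid converge in [L^2] to the Ito integral; for the given [r]
    it bounds their distance to the quadrature on the given grid by
    [mesh^rho], and this bound passes to the limit.

    The noise in [X] only adds another sum of the same kind.  The noise in [W] is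
    expanded by the mean value theorem (to second order in case (i), whose
    first-order term is once more a sum of the above kind) and the remainders
    factor into a part known at time [t_i] and a function of the increment, whose
    norms multiply by independence. *)

Require Import Defs.
From HB Require Import structures.
From mathcomp Require Import all_boot all_order all_algebra.
From mathcomp Require Import all_classical all_reals all_analysis.
From mathcomp Require Import measurable_realfun ring lra.
Import Order.TTheory GRing.Theory Num.Theory.
Import numFieldNormedType.Exports.
Local Open Scope classical_set_scope.
Local Open Scope ring_scope.
Set Implicit Arguments.
Unset Strict Implicit.
Unset Printing Implicit Defensive.

(** * Elementary inequalities and Gaussian moments *)

(** The constants must not depend on the probability space or the grid, so each moment bound fixes
    its constant before [P], [F] and [W] are introduced. Estimates are made on integrals of
    nonnegative functions; finiteness is checked where a term is cancelled.

    Two obstacles shape the passage to the Ito integral. Elementary processes approximate [X] only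
    on average over time, whereas a quadrature reads [X] at grid points; Holder continuity allows
    averaging over the cells of a fine grid. And convergence to the integral is known only in L^2,
    so the r-th moment is first bounded where the error is at most M, and M tends to infinity last.

    The three cases are one estimate with a growth exponent s, a remainder of orders a in time and m
    in space, and a first-order coefficient Q: (s, 1, 2, d_y p), (s, 1, 1, 0) and (0, alpha, beta,
    0). An increment to the power m has size dt^(m/2), and Minkowski adds remainders without
    cancellation, hence the sums in (ii) and (iii); in (i) they total 2 T. The weight (1 + |X|)(1 +
    |W|^s) is in L^r by Young's inequality if q > r; for s = 0 its second factor is constant and q =
    r suffices. *)

Section power_inequalities.
Context {R : realType}.
Implicit Types a b x y r m u v : R.

Lemma powR_le_mono r x y : 0 <= r -> 0 <= x -> x <= y -> x `^ r <= y `^ r.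
Proof.
by move=> r0 x0 xy; apply: ge0_ler_powR; rewrite // nnegrE ?(le_trans x0).
Qed.

(** Replacing the smaller base by the larger one gives Young's inequality without its sharp
    constants, also when one exponent is zero. *)
Lemma powRM_le_powRD a b u v : 0 <= a -> 0 <= b -> 0 <= u -> 0 <= v ->
  0 < u + v -> a `^ u * b `^ v <= a `^ (u + v) + b `^ (u + v).
Proof.
move=> a0 b0 u0 v0 uv; have [ab|/ltW ba] := leP a b.
- rewrite -[leLHS]add0r lerD ?powR_ge0// (@powRD _ b); last by rewrite gt_eqF.
  by rewrite ler_wpM2r ?powR_ge0// powR_le_mono.
- rewrite -[leLHS]addr0 lerD ?powR_ge0// (@powRD _ a); last by rewrite gt_eqF.
  by rewrite ler_wpM2l ?powR_ge0// powR_le_mono.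
Qed.

Lemma powRD_le a b r : 0 <= a -> 0 <= b -> 0 <= r ->
  (a + b) `^ r <= 2 `^ r * (a `^ r + b `^ r).
Proof.
move=> a0 b0 r0; rewrite mulrDr.
have [ab|/ltW ba] := leP a b.
- rewrite -[leLHS]add0r lerD ?mulr_ge0 ?powR_ge0// -powRM//.
  by rewrite powR_le_mono ?addr_ge0//; lra.
- rewrite -[leLHS]addr0 lerD ?mulr_ge0 ?powR_ge0// -powRM//.
  by rewrite powR_le_mono ?addr_ge0//; lra.
Qed.

(** The key is exp(x) (1 - x) <= 1, which bounds exp(x) by 1 + x exp(x); for x >= 0 a second use
    bounds x exp(x) by x + x^2 exp(x). *)
Lemma expR_le_quadratic x : expR x <= 1 + x + x ^+ 2 * expR `|x|.
Proof.
have h1 : expR x * (1 - x) <= 1.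
  rewrite -[leRHS](@divff _ (expR x)); last by rewrite gt_eqF ?expR_gt0.
  by rewrite -expRN ler_wpM2l ?expR_ge0// expR_ge1Dx.
have [/ltW x0|x0] := ltP x 0.
- have h2 := expR_ge1Dx x; have h3 : 1 <= expR `|x|.
    by rewrite -expR0 ler_expR.
  have h4 : 0 <= x ^+ 2 * (expR `|x| - 1).
    by rewrite mulr_ge0 ?sqr_ge0 ?subr_ge0.
  by nra.
- by rewrite ger0_norm//; nra.
Qed.

(** For |x| <= 1/2, ln(1 + x) <= x reduces the claim to the quadratic bound on exp(r x). For |x| >
    1/2, |1 + x| <= 3 |x|, and a negative r x is compensated by 2 r x^2, since |x| <= 2 x^2. *)
Lemma normr_powR1D r : 2 <= r -> exists2 K, 0 <= K & forall x,
  `|1 + x| `^ r <= 1 + r * x + K * (x ^+ 2 + `|x| `^ r).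
Proof.
move=> r2; have r0 : 0 <= r by lra.
pose K1 : R := r ^+ 2 * expR r; pose K2 : R := 3 `^ r + 2 * r.
have K10 : 0 <= K1 by rewrite mulr_ge0 ?sqr_ge0 ?expR_ge0.
have K20 : 0 <= K2 by rewrite addr_ge0 ?powR_ge0// mulr_ge0.
exists (K1 + K2) => [|x]; first exact: addr_ge0.
have xr := powR_ge0 `|x| r; have x2 := sqr_ge0 x.
have [xs|xl] := leP `|x| 2^-1.
- have x1 : 0 < 1 + x by move: xs; rewrite ler_norml; lra.
  rewrite gtr0_norm// /powR gt_eqF//.
  have e1 : expR (r * ln (1 + x)) <= expR (r * x).
    by rewrite ler_expR ler_wpM2l// le_ln1Dx//; lra.
  have := expR_le_quadratic (r * x); rewrite normrM (ger0_norm r0) => e2.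
  have e3 : expR (r * `|x|) <= expR r by rewrite ler_expR ler_piMr//; lra.
  have e4 : (r * x) ^+ 2 * expR (r * `|x|) <= K1 * x ^+ 2.
    rewrite exprMn mulrAC.
    by rewrite ler_wpM2r// ler_wpM2l ?sqr_ge0.
  move: K2 K20 => K2 K20; rewrite mulrDl !mulrDr.
  have : 0 <= K1 * `|x| `^ r by exact: mulr_ge0.
  have : 0 <= K2 * `|x| `^ r by exact: mulr_ge0.
  have : 0 <= K2 * x ^+ 2 by exact: mulr_ge0.
  move: xr; rewrite /powR; lra.
- have e1 : `|1 + x| `^ r <= 3 `^ r * `|x| `^ r.
    rewrite -powRM// powR_le_mono// (le_trans (ler_normD _ _))// normr1; lra.
  have e2 : - (2 * r * x ^+ 2) <= r * x.
    have : - `|x| <= x by rewrite lerNl ler_normr lexx orbT.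
    move/(ler_wpM2l r0); rewrite -(real_normK (num_real x)) => h.
    have : 0 <= r * (`|x| * (2 * `|x| - 1)).
      by rewrite !mulr_ge0// subr_ge0; lra.
    lra.
  have : 0 <= K1 * `|x| `^ r by exact: mulr_ge0.
  have : 0 <= K1 * x ^+ 2 by exact: mulr_ge0.
  have : 0 <= 3 `^ r * x ^+ 2 by rewrite mulr_ge0 ?powR_ge0.
  have : 0 <= 2 * r * `|x| `^ r by rewrite !mulr_ge0.
  rewrite /K2; lra.
Qed.

(* The first-order term has zero expectation when [b] is a centered variable
   independent of [a]. *)
Lemma normr_powRD_expand r : 2 <= r -> exists2 K, 0 <= K & forall a b,
  `|a + b| `^ r <= `|a| `^ r + r * `|a| `^ (r - 2) * a * b
                   + K * (`|a| `^ (r - 2) * b ^+ 2 + `|b| `^ r).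
Proof.
move=> r2; have [K K0 HK] := normr_powR1D r2.
exists (K + 1) => [|a b]; first exact: addr_ge0.
have [->|a0] := eqVneq a 0.
  rewrite add0r mulr0 mul0r normr0 powR0; last by apply/eqP; lra.
  have : 0 <= K * `|b| `^ r by rewrite mulr_ge0 ?powR_ge0.
  have : 0 <= (K + 1) * (0 `^ (r - 2) * b ^+ 2).
    apply: mulr_ge0; first exact: addr_ge0.
    by apply: mulr_ge0; [exact: powR_ge0|exact: sqr_ge0].
  lra.
have -> : a + b = a * (1 + b / a) by rewrite mulrDr mulr1 mulrCA divff ?mulr1.
rewrite normrM powRM//.
have a2 : `|a| `^ r = `|a| `^ (r - 2) * a ^+ 2.
  rewrite -(real_normK (num_real a)) -powR_mulrn// -powRD ?subrK//.
  by rewrite normr_eq0 a0 implybT.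
have ap : 0 <= `|a| `^ r := powR_ge0 _ _.
have -> : `|b| `^ r = `|a| `^ r * `|b / a| `^ r.
  by rewrite -powRM// -normrM mulrCA divff ?mulr1.
have -> : r * `|a| `^ (r - 2) * a * b = `|a| `^ r * (r * (b / a)).
  by rewrite a2; field.
have -> : `|a| `^ (r - 2) * b ^+ 2 = `|a| `^ r * (b / a) ^+ 2.
  by rewrite a2; field.
have := ler_wpM2l ap (HK (b / a)).
have : 0 <= `|a| `^ r * ((b / a) ^+ 2 + `|b / a| `^ r).
  by apply: mulr_ge0 => //; rewrite addr_ge0 ?sqr_ge0 ?powR_ge0.
lra.
Qed.

(** The tangent line of ln at 1, applied to x^2 / (2 m), produces the constant (2 m)^(m/2). The
    exponent x^2 / 4 is half the Gaussian one, so the product with the normal density stays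
    integrable. *)
Lemma normr_powR_le_expR m : 0 <= m ->
  exists2 K, 0 < K & forall x, `|x| `^ m <= K * expR (x ^+ 2 / 4).
Proof.
rewrite le_eqVlt => /predU1P[<-|m0].
  exists 1 => // x; rewrite powRr0 mul1r -[leLHS]expR0 ler_expR.
  by rewrite mulr_ge0 ?sqr_ge0 ?invr_ge0.
exists (expR (m / 2 * ln (2 * m))) => [|x]; first exact: expR_gt0.
have [->|x0] := eqVneq x 0.
  by rewrite normr0 powR0 ?gt_eqF// mulr_ge0 ?expR_ge0.
have nx : 0 < `|x| by rewrite normr_gt0.
rewrite /powR gt_eqF// -expRD ler_expR.
have h : ln (`|x| ^+ 2 / (2 * m)) <= `|x| ^+ 2 / (2 * m) - 1.
  have := @le_ln1Dx R (`|x| ^+ 2 / (2 * m) - 1).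
  rewrite (addrC 1) subrK; apply.
  by rewrite ltrBDr addrC subrr divr_gt0 ?exprn_gt0// mulr_gt0.
move: h; rewrite ln_div ?posrE ?exprn_gt0 ?mulr_gt0//.
rewrite lnXn// real_normK ?num_real// => h.
have {}h : m / 2 * (ln `|x| *+ 2 - ln (2 * m)) <=
    m / 2 * (x ^+ 2 / (2 * m) - 1).
  by rewrite ler_wpM2l// divr_ge0// ltW.
have e : m / 2 * (x ^+ 2 / (2 * m) - 1) = x ^+ 2 / 4 - m / 2.
  by field; exact: lt0r_neq0.
move: h; rewrite e -mulr_natr; lra.
Qed.
End power_inequalities.

Section normal_moments.
Context {R : realType}.
Local Notation mu := (@lebesgue_measure R).

(** The change of variables holds for the Radon-Nikodym derivative; it and the density integrate to
    the same law over every measurable set, hence agree almost everywhere. *)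
Lemma ge0_integral_normal_prob (m s : R) (f : R -> \bar R) :
  (forall x, 0 <= f x)%E -> measurable_fun setT f ->
  (\int[normal_prob m s]_x f x = \int[mu]_x (f x * (normal_pdf m s x)%:E))%E.
Proof.
move=> f0 mf; have dom := @normal_prob_dominates R m s.
rewrite -(Radon_Nikodym_SigmaFinite.change_of_variables dom)//.
have int_pdf := integrable_normal_pdf m s.
have int_rn := Radon_Nikodym_SigmaFinite.f_integrable dom.
apply: ae_eq_integral => //.
- by apply: emeasurable_funM => //; exact: (measurable_int mu int_rn).
- by apply: emeasurable_funM => //; exact: (measurable_int mu int_pdf).
apply: ae_eqe_mul2l; apply: integral_ae_eq => //.
- exact: measurable_int int_pdf.
- by move=> A _ mA; rewrite -Radon_Nikodym_SigmaFinite.f_integral.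
Qed.

Lemma normal_pdf_expR (s x : R) : 0 < s ->
  expR ((x / s) ^+ 2 / 4) * normal_pdf 0 s x =
  Num.sqrt 2 * normal_pdf 0 (s * Num.sqrt 2) x.
Proof.
move=> s0; have q2 : 0 < Num.sqrt 2 :> R by rewrite sqrtr_gt0.
rewrite !normal_pdfE ?mulf_neq0 ?gt_eqF//.
rewrite /normal_peak /normal_fun subr0 mulrCA [RHS]mulrA -expRD.
have -> : (s * Num.sqrt 2) ^+ 2 = s ^+ 2 * 2 by rewrite exprMn sqr_sqrtr.
congr (_ * expR _); last by field; rewrite gt_eqF.
have -> : s ^+ 2 * 2 * pi *+ 2 = 2 * (s ^+ 2 * pi *+ 2) by ring.
by rewrite sqrtrM// invfM mulrA divff ?mul1r ?gt_eqF.
Qed.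

(* [|x|^p <= K exp(x^2/4)] reduces the moment to the total mass of the normal law
   of standard deviation [s * sqrt 2]. *)
Lemma normal_prob_moment (p : R) : 0 <= p -> exists2 K, 0 < K & forall s : R,
  0 < s ->
  (\int[normal_prob 0 s]_x (`|x| `^ p)%:E <= (K * s `^ p)%:E)%E.
Proof.
move=> p0; have [K K0 HK] := normr_powR_le_expR p0.
have q2 : 0 < Num.sqrt 2 :> R by rewrite sqrtr_gt0.
exists (K * Num.sqrt 2) => [|s s0]; first exact: mulr_gt0.
have mp : measurable_fun setT (fun x : R => `|x| `^ p).
  by exact: (measurableT_comp (measurable_powR _)).
rewrite ge0_integral_normal_prob//; last exact/measurable_EFinP.
have c0 : 0 <= K * Num.sqrt 2 * s `^ p.
  by rewrite mulr_ge0 ?powR_ge0// mulr_ge0 ?ltW.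
rewrite -[leRHS]mule1 -(integral_normal_pdf 0 (s * Num.sqrt 2)).
have mpdf t : measurable_fun setT (fun x => (normal_pdf 0 t x : R)%:E).
  by apply/measurable_EFinP; exact: measurable_normal_pdf.
rewrite -ge0_integralZl_EFin//; last 2 first.
- by move=> x _; rewrite lee_fin normal_pdf_ge0.
- exact: mpdf.
apply: ge0_le_integral => //.
- by move=> x _; rewrite -EFinM lee_fin mulr_ge0 ?powR_ge0 ?normal_pdf_ge0.
- by apply: emeasurable_funM; [exact/measurable_EFinP|exact: mpdf].
- by apply: emeasurable_funM => //; exact: mpdf.
move=> x _; rewrite -!EFinM lee_fin.
have -> : K * Num.sqrt 2 * s `^ p * normal_pdf 0 (s * Num.sqrt 2) x =
  K * s `^ p * (Num.sqrt 2 * normal_pdf 0 (s * Num.sqrt 2) x) by ring.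
rewrite -normal_pdf_expR//.
have -> : `|x| `^ p = s `^ p * `|x / s| `^ p.
  rewrite -powRM ?(ltW s0)// -[s in s * _](gtr0_norm s0) -normrM mulrCA.
  by rewrite divff ?mulr1 ?gt_eqF.
have := HK (x / s); move/(ler_wpM2l (powR_ge0 s p)).
move/(ler_wpM2r (normal_pdf_ge0 0 s x)) => h.
by rewrite (le_trans h)// le_eqVlt; apply/orP; left; apply/eqP; ring.
Qed.

(** Reflection preserves Lebesgue measure and the density is even. In this form the centering of an
    increment is used without integrating a signed function. *)
Lemma normal_prob_sym (s : R) : 0 < s ->
  (\int[normal_prob 0 s]_x (Num.max x 0)%:E =
   \int[normal_prob 0 s]_x (Num.max (- x) 0)%:E)%E.
Proof.
move=> s0; rewrite !ge0_integral_normal_prob//; last 4 first.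
- by move=> x; rewrite lee_fin le_max lexx orbT.
- by apply/measurable_EFinP; apply: measurable_maxr => //; exact: measurableT_comp.
- by move=> x; rewrite lee_fin le_max lexx orbT.
- by apply/measurable_EFinP; exact: measurable_maxr.
have npdf (x : R) : normal_pdf 0 s (- x) = normal_pdf 0 s x.
  by rewrite normal_pdfE ?gt_eqF// /normal_fun !subr0 sqrrN.
transitivity (\int[pushforward mu (-%R : R -> measurableTypeR R)]_x
    ((Num.max x 0)%:E * (normal_pdf 0 s x)%:E))%E.
  by apply: eq_measure_integral => //= A mA _; rewrite -lebesgue_measureN.
rewrite ge0_integral_pushforward//=.
- by apply: eq_integral => x _; rewrite /= npdf.
- apply: emeasurable_funM; apply/measurable_EFinP; first exact: measurable_maxr.
  exact: measurable_normal_pdf.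
- move=> x _; rewrite -EFinM lee_fin mulr_ge0 ?normal_pdf_ge0//.
  by rewrite le_max lexx orbT.
Qed.
End normal_moments.

(** * Wiener increments and adapted sums *)

Section independence.
Context d (Omega : measurableType d) (R : realType).
Variables (P : probability Omega R) (G : set (set Omega)) (xi : Omega -> R).
Hypothesis Gm : G `<=` measurable.
Hypothesis mxi : measurable_fun setT xi.
Hypothesis indep : forall (A : set Omega) (B : set R), G A -> measurable B ->
  P (A `&` xi @^-1` B) = (P A * P (xi @^-1` B))%E.

Lemma sub_measurable_fun (U : Omega -> R) :
  sub_measurable G U -> measurable_fun setT U.
Proof. by move=> GU _ B mB; rewrite setTI; exact/Gm/GU. Qed.

(** Independence identifies the joint law of [U] and [xi] with the product of the marginals, on
    rectangles and hence everywhere; Tonelli then separates the integrals. *)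
Lemma ge0_integral_indep (U : Omega -> R) (g : R -> R) :
  sub_measurable G U -> (forall w, 0 <= U w) ->
  measurable_fun setT g -> (forall x, 0 <= g x) ->
  (\int[P]_w (U w * g (xi w))%:E =
   \int[P]_w (U w)%:E * \int[P]_w (g (xi w))%:E)%E.
Proof.
move=> GU U0 mg g0; have mU := sub_measurable_fun GU.
pose XU : {mfun Omega >-> R} := HB.pack U (isMeasurableFun.Build _ _ _ _ _ mU).
pose Xxi : {mfun Omega >-> R} :=
  HB.pack xi (isMeasurableFun.Build _ _ _ _ _ mxi).
have mpair : measurable_fun setT (fun w => (U w, xi w)).
  exact: measurable_fun_pair.
pose Xp : {mfun Omega >-> (R * R)%type} :=
  HB.pack (fun w => (U w, xi w)) (isMeasurableFun.Build _ _ _ _ _ mpair).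
pose mU' := distribution P XU; pose mxi' := distribution P Xxi.
pose mp := distribution P Xp.
have prodE : forall X, measurable X -> (mU' \x mxi')%E X = mp X.
  apply: product_measure_unique => A B mA mB.
  rewrite /mp /mU' /mxi' /distribution /pushforward /= -indep//; last exact: GU.
(* The absolute value makes [f] nonnegative on the whole plane and changes nothing on the values of
   [U]. *)
pose f (z : R * R) := (`|z.1| * g z.2)%:E.
have f0 z : (0 <= f z)%E by rewrite lee_fin mulr_ge0.
have mf : measurable_fun setT f.
  apply/measurable_EFinP; apply: measurable_funM.
    by apply: measurableT_comp => //; exact: measurable_fst.
  by apply: measurableT_comp => //; exact: measurable_snd.
transitivity (\int[mp]_z f z)%E.
  rewrite ge0_integral_distribution//; apply: eq_integral => w _.
  by rewrite /f/= ger0_norm.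
transitivity (\int[mU' \x mxi']_z f z)%E.
  by apply: eq_measure_integral => A mA _; exact/esym/prodE.
rewrite fubini_tonelli1//= /fubini_F.
have mn : measurable_fun setT (fun x : R => (`|x|)%:E).
  by apply/measurable_EFinP; exact: normr_measurable.
transitivity (\int[mU']_x (`|x|%:E * \int[P]_w (g (xi w))%:E))%E.
  apply: eq_integral => x _; rewrite /f /=; under eq_integral do rewrite EFinM.
  rewrite ge0_integralZl_EFin//=; last 2 first.
  - by move=> ? _; rewrite lee_fin.
  - exact/measurable_EFinP.
  by rewrite ge0_integral_distribution//=; exact/measurable_EFinP.
rewrite ge0_integralZr//; last by apply: integral_ge0 => w _; rewrite lee_fin.
congr (_ * _)%E.
rewrite ge0_integral_distribution//; apply: eq_integral => w _ /=.
by rewrite ger0_norm.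
Qed.
End independence.

Section ge0_integral_real.
Context d (Omega : measurableType d) (R : realType).
Variable mu : {measure set Omega -> \bar R}.
Implicit Types f g : Omega -> R.

(* The integral of a nonnegative function, measurable or not, is the supremum of
   the integrals of the simple functions below it. *)
Lemma ge0_le_integralT (f g : Omega -> \bar R) : (forall w, 0 <= f w)%E ->
  (forall w, f w <= g w)%E -> (\int[mu]_w f w <= \int[mu]_w g w)%E.
Proof.
move=> f0 fg; have g0 w : (0 <= g w)%E by exact: le_trans (fg w).
rewrite !ge0_integralTE//; apply: ereal_sup_le => _ [h hf <-].
by exists h => // w; exact: le_trans (fg w).
Qed.

Lemma le_integral_EFin f g : (forall w, 0 <= f w) -> (forall w, f w <= g w) ->
  (\int[mu]_w (f w)%:E <= \int[mu]_w (g w)%:E)%E.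
Proof. by move=> f0 fg; apply: ge0_le_integralT => w; rewrite lee_fin. Qed.

Lemma ge0_integralD_EFin f g : measurable_fun setT f -> measurable_fun setT g ->
  (forall w, 0 <= f w) -> (forall w, 0 <= g w) ->
  (\int[mu]_w (f w + g w)%:E = \int[mu]_w (f w)%:E + \int[mu]_w (g w)%:E)%E.
Proof.
move=> mf mg f0 g0; under eq_integral do rewrite EFinD.
by rewrite ge0_integralD//;
  solve [exact/measurable_EFinP | move=> w _; rewrite lee_fin //].
Qed.

Lemma ge0_integralZ_EFin k f : 0 <= k -> measurable_fun setT f ->
  (forall w, 0 <= f w) ->
  (\int[mu]_w (k * f w)%:E = k%:E * \int[mu]_w (f w)%:E)%E.
Proof.
move=> k0 mf f0; under eq_integral do rewrite EFinM.
by rewrite ge0_integralZl_EFin//;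
  solve [exact/measurable_EFinP | move=> w _; rewrite lee_fin //].
Qed.
End ge0_integral_real.

Section sub_measurable_theory.
Context d (Omega : measurableType d) (R : realType) (G : set (set Omega)).
Hypothesis sG : sigma_algebra setT G.

(** Adaptedness becomes measurability on a measurable space, where the closure rules for sums,
    products and compositions apply. *)
Lemma sub_measurableP (U : Omega -> R) : sub_measurable G U <->
  measurable_fun [set: g_sigma_algebraType G] (U : g_sigma_algebraType G -> R).
Proof.
split=> [GU _ B mB|mU B mB].
  by rewrite setTI; apply: sub_sigma_algebra; exact: GU.
have := mU measurableT B mB; rewrite setTI.
by rewrite /measurable/= /g_sigma_algebraType/= (sigma_algebra_id sG).
Qed.
End sub_measurable_theory.

Section discretization_theory.
Context {R : realType} (T : R) (n : nat) (t : nat -> R).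
Hypothesis tP : discretization T n t.

Lemma discretization_homo i j : (i <= j)%N -> (j <= n)%N -> t i <= t j.
Proof.
case: tP => _ _ tS; elim: j => [|j IH].
  by rewrite leqn0 => /eqP ->.
rewrite leq_eqVlt => /predU1P[->//|ij] jn.
by rewrite (le_trans (IH ij (ltnW jn)))// ltW// tS.
Qed.

Lemma discretization_itv i : (i <= n)%N -> 0 <= t i <= T.
Proof.
move=> ni; have [t0 tn _] := tP.
by rewrite -t0 -tn !discretization_homo.
Qed.

Lemma discretization_sum : \sum_(i < n) (t i.+1 - t i) = T.
Proof.
have [t0 tn _] := tP.
rewrite -(big_mkord xpredT (fun i => t i.+1 - t i)) telescope_sumr//.
by rewrite t0 tn subr0.
Qed.
End discretization_theory.

Section wiener_increments.
Context d (Omega : measurableType d) (R : realType) (P : probability Omega R).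
Variables (F : R -> set (set Omega)) (W : R -> Omega -> R).
Hypotheses (filF : filtration F) (wienerW : wiener_process P F W).

Lemma filtration_sigma t : 0 <= t -> sigma_algebra setT (F t).
Proof. by move=> /(filF.1)[]. Qed.

Lemma filtration_measurable t : 0 <= t -> F t `<=` measurable.
Proof. by move=> /(filF.1)[]. Qed.

Lemma sub_measurable_homo s t U :
  0 <= s -> s <= t -> sub_measurable (F s) U -> sub_measurable (F t) (U : _ -> R).
Proof. by move=> s0 st FU B /FU; exact: filF.2. Qed.

Lemma adapted_measurable t (U : Omega -> R) :
  0 <= t -> sub_measurable (F t) U -> measurable_fun setT U.
Proof. by move=> t0; apply: sub_measurable_fun; exact: filtration_measurable. Qed.

Lemma wiener_sub_measurable t : 0 <= t -> sub_measurable (F t) (W t).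
Proof. by case: wienerW => _ _ + _ _; exact. Qed.

Lemma wiener_measurable t : 0 <= t -> measurable_fun setT (W t).
Proof. by move=> t0; exact/(adapted_measurable t0)/wiener_sub_measurable. Qed.

Section increment.
Variables (s t : R) (s0 : 0 <= s) (st : s < t).
Local Notation xi := (W t \- W s).

Lemma wiener_incr_measurable : measurable_fun setT xi.
Proof.
by apply: measurable_funB; apply: wiener_measurable; rewrite // (le_trans s0) ?ltW.
Qed.

Lemma ge0_integral_wiener_incr (g : R -> R) :
  measurable_fun setT g -> (forall x, 0 <= g x) ->
  (\int[P]_w (g (xi w))%:E =
   \int[normal_prob 0 (Num.sqrt (t - s))]_x (g x)%:E)%E.
Proof.
move=> mg g0.
have mxi : measurable_fun setT (xi : Omega -> measurableTypeR R).
  exact: wiener_incr_measurable.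
pose X : {mfun Omega >-> measurableTypeR R} :=
  HB.pack xi (isMeasurableFun.Build _ _ _ _ _ mxi).
have -> : (\int[P]_w (g (xi w))%:E = \int[distribution P X]_x (g x)%:E)%E.
  by rewrite ge0_integral_distribution//; exact/measurable_EFinP.
have [_ _ _ law _] := wienerW.
by apply: eq_measure_integral => A mA _; rewrite /= -law.
Qed.

Lemma wiener_incr_sym : (\int[P]_w (Num.max (xi w) 0)%:E =
  \int[P]_w (Num.max (- xi w) 0)%:E)%E.
Proof.
rewrite (@ge0_integral_wiener_incr (Num.max ^~ 0)); last 2 first.
- exact: measurable_maxr.
- by move=> x; rewrite le_max lexx orbT.
rewrite (@ge0_integral_wiener_incr (fun x => Num.max (- x) 0)); last 2 first.
- by apply: measurable_maxr => //; exact: measurableT_comp.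
- by move=> x; rewrite le_max lexx orbT.
by rewrite normal_prob_sym// sqrtr_gt0 subr_gt0.
Qed.

Lemma ge0_integral_wiener_indep (U : Omega -> R) (g : R -> R) :
  sub_measurable (F s) U -> (forall w, 0 <= U w) ->
  measurable_fun setT g -> (forall x, 0 <= g x) ->
  (\int[P]_w (U w * g (xi w))%:E =
   \int[P]_w (U w)%:E * \int[P]_w (g (xi w))%:E)%E.
Proof.
apply: ge0_integral_indep; first exact: filtration_measurable.
- exact: wiener_incr_measurable.
- by case: wienerW => _ _ _ _ + A B FA mB; exact.
Qed.
End increment.
End wiener_increments.

Lemma wiener_incr_moment (R : realType) (p : R) : 0 <= p ->
  exists2 K, 0 < K & forall d (Omega : measurableType d)
    (P : probability Omega R) (F : R -> set (set Omega)) (W : R -> Omega -> R),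
  filtration F -> wiener_process P F W -> forall s t, 0 <= s -> s < t ->
  (\int[P]_w (`|W t w - W s w| `^ p)%:E <= (K * (t - s) `^ (p / 2))%:E)%E.
Proof.
move=> p0; have [K K0 HK] := normal_prob_moment p0.
exists K => // d Omega P F W filF wW s t s0 st.
rewrite (ge0_integral_wiener_incr filF wW s0 st (g := fun x => `|x| `^ p)).
- rewrite (le_trans (HK _ _)) ?sqrtr_gt0 ?subr_gt0//.
  by rewrite -powR12_sqrt ?subr_ge0 ?(ltW st)// -powRrM [2^-1 * p]mulrC.
- exact: (measurableT_comp (measurable_powR _)).
- by move=> x; exact: powR_ge0.
Qed.

Section martingale_transform.
Context {R : realType}.

Lemma wiener_step_moment (r T : R) : 2 <= r -> 0 < T ->
  exists2 K, 0 < K & forall d (Omega : measurableType d)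
    (P : probability Omega R) (F : R -> set (set Omega)) (W : R -> Omega -> R),
  filtration F -> wiener_process P F W ->
  forall s t, 0 <= s -> s < t -> t <= T ->
  forall (M Y : Omega -> R) (m y : R),
  sub_measurable (F s) M -> sub_measurable (F s) Y ->
  (\int[P]_w (`|M w| `^ r)%:E <= m%:E)%E ->
  (\int[P]_w (`|Y w| `^ r)%:E <= y%:E)%E ->
  (\int[P]_w (`|M w + Y w * (W t w - W s w)| `^ r)%:E <=
   (m + K * (m + y) * (t - s))%:E)%E.
Proof.
move=> r2 T0; have r0 : 0 < r by lra.
have [K0 K00 HK0] := normr_powRD_expand r2.
have [K1 K10 HK1] := @wiener_incr_moment R 1 ler01.
have [K2 K20 HK2] := @wiener_incr_moment R 2 ltac:(by []).
have [Kr Kr0 HKr] := @wiener_incr_moment R r (ltW r0).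
(* [K0] comes from the second-order expansion, [K2] and [Kr] from the increment moments of orders 2
   and r; the summand 1 ensures positivity. *)
exists (K0 * (K2 + Kr * T `^ (r / 2 - 1)) + 1).
  by rewrite ltr_wpDl// mulr_ge0// addr_ge0 ?mulr_ge0 ?powR_ge0// ltW.
move=> d Omega P F W filF wW s t s0 st tT M Y m y FM FY Mm Yy.
have sG := filtration_sigma filF s0.
have Gm := filtration_measurable filF s0.
pose xi w := W t w - W s w.
have ind := ge0_integral_wiener_indep filF wW s0 st.
pose V w := r * `|M w| `^ (r - 2) * M w * Y w.
pose Vp w := Num.max (V w) 0; pose Vn w := Num.max (- V w) 0.
pose A w := `|M w| `^ (r - 2) * Y w ^+ 2.
pose Yr w := `|Y w| `^ r.
pose pos x : R := Num.max x 0; pose neg x : R := Num.max (- x) 0.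
have FM' := (sub_measurableP sG _).1 FM.
have FY' := (sub_measurableP sG _).1 FY.
have mnorm p : measurable_fun setT (fun x : R => `|x| `^ p).
  exact: (measurableT_comp (measurable_powR _)).
have FV : measurable_fun [set: g_sigma_algebraType (F s)] V.
  apply: measurable_funM => //; apply: measurable_funM => //.
  by apply: measurable_funM => //; exact: measurableT_comp (mnorm _) _.
have FVp : sub_measurable (F s) Vp.
  by apply/(sub_measurableP sG); exact: measurable_maxr.
have FVn : sub_measurable (F s) Vn.
  apply/(sub_measurableP sG); apply: measurable_maxr => //.
  exact: measurableT_comp.
have FA : sub_measurable (F s) A.
  apply/(sub_measurableP sG); apply: measurable_funM.
    exact: measurableT_comp (mnorm _) _.
  exact: measurable_funX.
have FYr : sub_measurable (F s) Yr.
  by apply/(sub_measurableP sG); exact: measurableT_comp (mnorm _) _.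
have FMr : sub_measurable (F s) (fun w => `|M w| `^ r).
  by apply/(sub_measurableP sG); exact: measurableT_comp (mnorm _) _.
have mM := adapted_measurable filF s0 FM.
have mY := adapted_measurable filF s0 FY.
have mVp := adapted_measurable filF s0 FVp.
have mVn := adapted_measurable filF s0 FVn.
have mA := adapted_measurable filF s0 FA.
have mYr := adapted_measurable filF s0 FYr.
have mMr := adapted_measurable filF s0 FMr.
have mxi : measurable_fun setT xi by have := wiener_incr_measurable filF wW s0 st.
have pos0 x : 0 <= pos x by rewrite le_max lexx orbT.
have neg0 x : 0 <= neg x by rewrite le_max lexx orbT.
have mpos : measurable_fun setT pos by exact: measurable_maxr.
have mneg : measurable_fun setT neg.
  by apply: measurable_maxr => //; exact: measurableT_comp.
have Vp0 w : 0 <= Vp w by rewrite le_max lexx orbT.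
have Vn0 w : 0 <= Vn w by rewrite le_max lexx orbT.
have A0 w : 0 <= A w by rewrite mulr_ge0 ?sqr_ge0 ?powR_ge0.
have Yr0 w : 0 <= Yr w by exact: powR_ge0.
(* Splitting [V * xi] into positive and negative parts keeps every integral
   nonnegative; the two sides then share the finite term [c], as [xi] has a
   symmetric law. *)
have ptw w : `|M w + Y w * xi w| `^ r + (Vp w * neg (xi w) + Vn w * pos (xi w))
    <= `|M w| `^ r + (Vp w * pos (xi w) + Vn w * neg (xi w))
       + K0 * (A w * `|xi w| `^ 2 + Yr w * `|xi w| `^ r).
  have := HK0 (M w) (Y w * xi w).
  rewrite normrM powRM// exprMn powR_mulrn// real_normK ?num_real//.
  have maxB (x : R) : x = Num.max x 0 - Num.max (- x) 0.
    by rewrite /Num.max oppr_lt0; case: ltgtP => ?; lra.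
  have : V w * xi w = (Vp w - Vn w) * (pos (xi w) - neg (xi w)).
    by rewrite -!maxB.
  rewrite /V /A /Yr; lra.
pose I (f : Omega -> R) := (\int[P]_w (f w)%:E)%E.
have I0 f : (forall w, 0 <= f w) -> (0 <= I f)%E.
  by move=> f0; apply: integral_ge0 => w _; rewrite lee_fin.
have dt0 : 0 <= t - s by rewrite subr_ge0 ltW.
have {}HK1 := HK1 _ _ P F W filF wW s t s0 st.
have {}HK2 := HK2 _ _ P F W filF wW s t s0 st.
have {}HKr := HKr _ _ P F W filF wW s t s0 st.
have Ee : I (pos \o xi) = I (neg \o xi) by have := wiener_incr_sym filF wW s0 st.
have Efin : I (pos \o xi) \is a fin_num.
  rewrite ge0_fin_numE; last by apply: I0 => w; exact: pos0.
  apply: (le_lt_trans _ (ltry (K1 * (t - s) `^ (1 / 2)))).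
  apply: le_trans HK1; apply: le_integral_EFin => w //=.
  by rewrite powRr1// ge_max ler_norm normr_ge0.
(* Young's inequality bounds the first-order weight r |M|^(r-1) |Y| by r-th powers; this makes the
   common term [c] finite, so that it can be cancelled. *)
have Vle w : Vp w <= r * (`|M w| `^ r + Yr w) /\ Vn w <= r * (`|M w| `^ r + Yr w).
  have : `|V w| <= r * (`|M w| `^ r + Yr w).
    rewrite /V !normrM (ger0_norm (ltW r0)) (ger0_norm (powR_ge0 _ _)).
    rewrite -!mulrA ler_wpM2l ?(ltW r0)// mulrA -{2}(powRr1 (normr_ge0 (M w))).
    rewrite -powRD; last by rewrite (_ : r - 2 + 1 == 0 = false)//; apply/eqP; lra.
    rewrite -(powRr1 (normr_ge0 (Y w))).
    have := @powRM_le_powRD R `|M w| `|Y w| (r - 2 + 1) 1.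
    by rewrite (_ : r - 2 + 1 + 1 = r); [apply => //; lra|ring].
  have h0 : 0 <= r * (`|M w| `^ r + Yr w).
    by rewrite mulr_ge0 ?(ltW r0)// addr_ge0 ?powR_ge0.
  by rewrite ler_norml /Vp /Vn !ge_max h0 !andbT => /andP[]; rewrite lerNl.
have VIfin (f : Omega -> R) : (forall w, 0 <= f w) ->
    (forall w, f w <= r * (`|M w| `^ r + Yr w)) -> I f \is a fin_num.
  move=> f0 fle; rewrite ge0_fin_numE ?I0//.
  apply: (@le_lt_trans _ _ (r%:E * (m%:E + y%:E))%E); last exact: ltry.
  rewrite (le_trans (le_integral_EFin P f0 fle))//.
  rewrite ge0_integralZ_EFin ?(ltW r0)//; last 2 first.
  - by apply: measurable_funD.
  - by move=> w; rewrite addr_ge0 ?powR_ge0.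
  rewrite lee_wpmul2l ?lee_fin ?(ltW r0)//.
  by rewrite ge0_integralD_EFin ?leeD// => w; exact: powR_ge0.
have Vpfin : I Vp \is a fin_num by apply: VIfin => // w; case: (Vle w).
have Vnfin : I Vn \is a fin_num by apply: VIfin => // w; case: (Vle w).
pose c := (I Vp * I (pos \o xi) + I Vn * I (pos \o xi))%E.
have cfin : c \is a fin_num by rewrite fin_numD !fin_numM.
have mposxi : measurable_fun setT (fun w => pos (xi w)).
  exact: (measurableT_comp mpos).
have mnegxi : measurable_fun setT (fun w => neg (xi w)).
  exact: (measurableT_comp mneg).
have mxip p : measurable_fun setT (fun w => `|xi w| `^ p).
  exact: (measurableT_comp (mnorm p)).
have lhsE : I (fun w => `|M w + Y w * xi w| `^ r +
    (Vp w * neg (xi w) + Vn w * pos (xi w))) =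
    (I (fun w => (`|M w + Y w * xi w| `^ r)%R) + c)%E.
  rewrite /I ge0_integralD_EFin; first last.
  - by move=> w; rewrite addr_ge0// mulr_ge0.
  - by move=> w; exact: powR_ge0.
  - by apply: measurable_funD; exact: measurable_funM.
  - apply: (measurableT_comp (mnorm r)).
    by apply: measurable_funD => //; exact: measurable_funM.
  congr (_ + _)%E; rewrite ge0_integralD_EFin; first last.
  - by move=> w; rewrite mulr_ge0.
  - by move=> w; rewrite mulr_ge0.
  - exact: measurable_funM.
  - exact: measurable_funM.
  by rewrite (ind Vp neg)// (ind Vn pos)// -[X in (_ * X + _)%E]Ee.
have rhsE : I (fun w => `|M w| `^ r + (Vp w * pos (xi w) + Vn w * neg (xi w))
       + K0 * (A w * `|xi w| `^ 2 + Yr w * `|xi w| `^ r)) =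
    (I (fun w => (`|M w| `^ r)%R) + c + K0%:E *
      (I A * I (fun w => (`|xi w| `^ 2)%R) +
       I Yr * I (fun w => (`|xi w| `^ r)%R)))%E.
  rewrite /I ge0_integralD_EFin; first last.
  - by move=> w; rewrite mulr_ge0// addr_ge0// mulr_ge0// powR_ge0.
  - by move=> w; rewrite addr_ge0 ?powR_ge0// addr_ge0// mulr_ge0.
  - apply: measurable_funM => //.
    by apply: measurable_funD; exact: measurable_funM.
  - apply: measurable_funD => //.
    by apply: measurable_funD; exact: measurable_funM.
  congr (_ + _)%E.
    rewrite ge0_integralD_EFin//; first last.
    - by move=> w; rewrite addr_ge0// mulr_ge0.
    - by apply: measurable_funD; exact: measurable_funM.
    congr (_ + _)%E; rewrite ge0_integralD_EFin; first last.
    - by move=> w; rewrite mulr_ge0.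
    - by move=> w; rewrite mulr_ge0.
    - exact: measurable_funM.
    - exact: measurable_funM.
    by rewrite (ind Vp pos)// (ind Vn neg)// -[X in (_ + _ * X)%E]Ee.
  rewrite ge0_integralZ_EFin//; first last.
  - by move=> w; rewrite addr_ge0// mulr_ge0// powR_ge0.
  - by apply: measurable_funD; exact: measurable_funM.
  congr (_ * _)%E; rewrite ge0_integralD_EFin; first last.
  - by move=> w; rewrite mulr_ge0 ?powR_ge0.
  - by move=> w; rewrite mulr_ge0 ?powR_ge0.
  - exact: measurable_funM.
  - exact: measurable_funM.
  by rewrite (ind A (fun x => `|x| `^ 2))// ?(ind Yr (fun x => `|x| `^ r)).
have m0 : 0 <= m by rewrite -lee_fin (le_trans _ Mm)// I0// => w; exact: powR_ge0.
have y0 : 0 <= y by rewrite -lee_fin (le_trans _ Yy)// I0.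
have Ale : (I A <= (m + y)%:E)%E.
  apply: (@le_trans _ _ (I (fun w => `|M w| `^ r + `|Y w| `^ r))).
    apply: le_integral_EFin => // w; rewrite /A -(real_normK (num_real (Y w))).
    have := @powRM_le_powRD R `|M w| `|Y w| (r - 2) 2.
    by rewrite subrK powR_mulrn//; apply => //; lra.
  by rewrite /I ge0_integralD_EFin// ?EFinD ?leeD// => w; exact: powR_ge0.
rewrite -(leeD2rE _ _ cfin) -lhsE.
apply: (le_trans (le_integral_EFin P _ ptw)).
  by move=> w; rewrite addr_ge0 ?powR_ge0// addr_ge0// mulr_ge0.
rewrite -/(I _) rhsE addeAC leeD2r//.
apply: (@le_trans _ _ (m%:E + K0%:E * ((m + y)%:E * (K2 * (t - s))%:E +
    y%:E * (Kr * (t - s) `^ (r / 2))%:E))%E).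
  rewrite leeD// lee_wpmul2l ?lee_fin// leeD// lee_pmul//.
  - exact: I0.
  - by apply: I0 => w; exact: powR_ge0.
  - by apply: le_trans HK2 _; rewrite divff// powRr1.
  - exact: I0.
  - by apply: I0 => w; exact: powR_ge0.
rewrite -!EFinM -!EFinD lee_fin lerD2l.
(* As r >= 2, the exponent r/2 - 1 is nonnegative and the power r/2 is at most linear in the step;
   the step errors can therefore be summed over any grid. *)
have hd : (t - s) `^ (r / 2) <= T `^ (r / 2 - 1) * (t - s).
  have -> : (t - s) `^ (r / 2) = (t - s) `^ (r / 2 - 1) * (t - s).
    rewrite -{3}(powRr1 dt0) -powRD ?subrK//.
    by rewrite subr_eq0 (gt_eqF st) implybT.
  by rewrite ler_wpM2r// powR_le_mono//; lra.
have h1 : y * (Kr * (t - s) `^ (r / 2)) <=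
    (m + y) * (Kr * (T `^ (r / 2 - 1) * (t - s))).
  apply: ler_pM => //; rewrite ?mulr_ge0 ?powR_ge0 ?(ltW Kr0) ?lerDr//.
  by rewrite ler_wpM2l// ltW.
have h2 : 0 <= (m + y) * (t - s) by rewrite mulr_ge0// addr_ge0.
have := ler_wpM2l K00 h1; lra.
Qed.
End martingale_transform.

Section martingale_sum.
Context {R : realType}.

Lemma sub_measurable_sum d (Omega : measurableType d) (G : set (set Omega))
    (n : nat) (f : nat -> Omega -> R) : sigma_algebra setT G ->
  (forall i, (i < n)%N -> sub_measurable G (f i)) ->
  sub_measurable G (fun w => \sum_(i < n) f i w).
Proof.
move=> sG Gf; apply/(sub_measurableP sG).
elim: n Gf => [|n IH] Gf.
  by under eq_fun do rewrite big_ord0; exact: measurable_cst.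
under eq_fun do rewrite big_ord_recr/=.
apply: measurable_funD; last by apply/(sub_measurableP sG); exact: Gf.
by apply: IH => i /ltnW ni; exact: Gf.
Qed.

Lemma wiener_sum_moment (r T : R) : 2 <= r -> 0 < T ->
  exists2 K, 0 < K & forall d (Omega : measurableType d)
    (P : probability Omega R) (F : R -> set (set Omega)) (W : R -> Omega -> R),
  filtration F -> wiener_process P F W ->
  forall n t, discretization T n t ->
  forall (Y : nat -> Omega -> R) (y : nat -> R),
  (forall i, (i < n)%N -> sub_measurable (F (t i)) (Y i)) ->
  (forall i, (i < n)%N -> (\int[P]_w (`|Y i w| `^ r)%:E <= (y i)%:E)%E) ->
  (\int[P]_w (`|\sum_(i < n) Y i w * (W (t i.+1) w - W (t i) w)| `^ r)%:E <=
   (K * \sum_(i < n) y i * (t i.+1 - t i))%:E)%E.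
Proof.
move=> r2 T0; have [K K0 HK] := wiener_step_moment r2 T0.
exists (K * expR (K * T)) => [|d Omega P F W filF wW n t tP Y y FY Yy].
  by rewrite mulr_gt0 ?expR_gt0.
have y0 i : (i < n)%N -> 0 <= y i.
  move=> ni; rewrite -lee_fin (le_trans _ (Yy i ni))//.
  by apply: integral_ge0 => w _; rewrite lee_fin powR_ge0.
pose M k w := \sum_(i < k) Y i w * (W (t i.+1) w - W (t i) w).
have t0 i : (i <= n)%N -> 0 <= t i by move=> /(discretization_itv tP)/andP[].
have FM k : (k <= n)%N -> sub_measurable (F (t k)) (M k).
  move=> kn; have sk := filtration_sigma filF (t0 _ kn).
  apply: (@sub_measurable_sum _ _ _ k
    (fun i w => Y i w * (W (t i.+1) w - W (t i) w))) => // i ik.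
  have ti j : (j <= k)%N -> t j <= t k by move=> jk; exact: (discretization_homo tP).
  have adapt j U : (j <= k)%N -> sub_measurable (F (t j)) U ->
      measurable_fun [set: g_sigma_algebraType (F (t k))] (U : _ -> R).
    move=> jk FU; apply/(sub_measurableP sk).
    by apply: sub_measurable_homo FU; rewrite ?t0 ?ti// (leq_trans jk).
  have FW j : (j <= k)%N -> sub_measurable (F (t j)) (W (t j)).
    by move=> jk; apply: (wiener_sub_measurable wW); rewrite t0// (leq_trans jk).
  apply/(sub_measurableP sk); apply: measurable_funM.
    by apply: (adapt i) (FY i _); [exact: ltnW|exact: leq_trans kn].
  by apply: measurable_funB; apply: adapt (FW _ _) => //; exact: ltnW.
pose S k := \sum_(i < k) y i * (t i.+1 - t i).
have dt0 i : (i < n)%N -> 0 <= t i.+1 - t i.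
  by move=> ni; rewrite subr_ge0 ltW//; case: tP => _ _; exact.
have S0 k : (k <= n)%N -> 0 <= S k.
  move=> kn; apply: sumr_ge0 => i _.
  have ni : (i < n)%N by apply: leq_trans kn.
  by rewrite mulr_ge0 ?y0 ?dt0.
(* Discrete Gronwall: over one step exp(K t_k) grows by at least the factor 1 + K dt that multiplies
   the previous moment. At k = n it equals exp(K T). *)
suff H k : (k <= n)%N ->
    (\int[P]_w (`|M k w| `^ r)%:E <= (expR (K * t k) * K * S k)%:E)%E.
  have := H _ (leqnn n); have [_ -> _] := tP.
  by rewrite (mulrC (expR _)).
elim: k => [|k IH] kn.
  rewrite /S big_ord0 mulr0 /M; under eq_integral do
    rewrite big_ord0 normr0 powR0 ?gt_eqF ?(lt_le_trans _ r2)//.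
  by rewrite integral0.
have tk : t k < t k.+1 by case: tP => _ _; exact.
have tkT : t k.+1 <= T by have /andP[] := discretization_itv tP kn.
have := HK _ _ P F W filF wW _ _ (t0 _ (ltnW kn)) tk tkT _ _ _ _
  (FM _ (ltnW kn)) (FY _ kn) (IH (ltnW kn)) (Yy _ kn).
under eq_integral => w _ do rewrite
  -[X in `|X|](big_ord_recr k (fun i => Y i w * (W (t i.+1) w - W (t i) w))).
move=> /le_trans; apply; rewrite lee_fin.
rewrite [X in _ <= _ * X]big_ord_recr/= -/(S k).
set D := t k.+1 - t k; have D0 : 0 <= D by exact: dt0.
have -> : K * t k.+1 = K * t k + K * D by rewrite /D; ring.
rewrite expRD; set E := expR (K * t k); set E' := expR (K * D).
have E1 : 1 <= E by rewrite -expR0 ler_expR mulr_ge0 ?t0 1?ltnW// ltW.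
have E'1 : 1 + K * D <= E' by exact: expR_ge1Dx.
have KD : 0 <= K * D by rewrite mulr_ge0// ltW.
have h1 := ler_wpM2l
  (mulr_ge0 (mulr_ge0 (le_trans ler01 E1) (ltW K0)) (S0 _ (ltnW kn))) E'1.
have h2 : K * (y k * D) <= E * E' * (K * (y k * D)).
  rewrite ler_peMl ?mulr_ge0 ?y0 ?(ltW K0)//.
  by rewrite mulr_ege1//; lra.
lra.
Qed.
End martingale_sum.

(** * Refinements and approximation of the Ito integral *)

Section refinement.
Context {R : realType} (T : R).

Definition refines (N : nat) (s : nat -> R) (n : nat) (t : nat -> R) :=
  forall i, (i <= n)%N -> exists2 k, (k <= N)%N & s k = t i.

Lemma discretization_of_seq (l : seq R) :
  (forall x, x \in l -> 0 <= x <= T) -> 0 \in l -> T \in l ->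
  exists N s, discretization T N s /\
    forall x, x \in l -> exists2 k, (k <= N)%N & s k = x.
Proof.
move=> l0T l0 lT; pose r := sort <=%R (undup l).
have memr x : (x \in r) = (x \in l) by rewrite mem_sort mem_undup.
have srt : sorted <%R r by rewrite sort_lt_sorted undup_uniq.
have szr : (0 < size r)%N by case: r memr {srt} => // /(_ 0); rewrite l0.
have szr1 : (size r).-1.+1 = size r by rewrite prednK.
have rle i j : (i <= j)%N -> (j < size r)%N -> nth 0 r i <= nth 0 r j.
  move=> ij jr; rewrite lt_sorted_leq_nth// inE//; exact: leq_ltn_trans ij jr.
have rP k : (k < size r)%N -> 0 <= nth 0 r k <= T.
  by move=> kr; apply: l0T; rewrite -memr mem_nth.
(* [N] counts cells, one fewer than the distinct sorted points. *)
exists (size r).-1, (nth 0 r); split=> [|x]; last first.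
  rewrite -memr => xr; exists (index x r); last exact: nth_index.
  by rewrite -ltnS szr1 index_mem.
split.
- apply/eqP; rewrite eq_le; have /andP[-> _] := rP _ szr; rewrite andbT.
  rewrite -memr in l0; rewrite -[leRHS](nth_index 0 l0).
  by rewrite rle// index_mem.
- apply/eqP; rewrite eq_le; have /andP[_ ->] := rP (size r).-1 ltac:(by rewrite szr1).
  rewrite -memr in lT; rewrite -[leLHS](nth_index 0 lT) rle ?szr1//.
  by rewrite -ltnS szr1 index_mem.
- move=> i; rewrite -ltnS szr1 => ir; rewrite lt_sorted_ltn_nth// inE//.
  exact: ltnW.
Qed.

(** The upper limit [m] stays free for the induction; the minima cover the limits that have not yet
    reached [k] or [l]. *)
Lemma telescope_sum_indicator (g : nat -> R) k l m : (k <= l)%N ->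
  \sum_(j < m) (k <= j < l)%N%:R * (g j.+1 - g j) =
  g (minn m l) - g (minn m k).
Proof.
move=> kl; elim: m => [|m IH]; first by rewrite big_ord0 !min0n subrr.
rewrite big_ord_recr/= IH.
have [mk|km] := ltnP m k.
  have ml : (m < l)%N by apply: leq_trans kl.
  rewrite /= mul0r addr0 (minn_idPl mk).
  by rewrite (minn_idPl ml) (minn_idPl (ltnW ml)) !subrr.
have [ml|lm] := ltnP m l.
  by rewrite /= mul1r (minn_idPr (leqW km)) (minn_idPl ml); ring.
by rewrite /= mul0r addr0 (minn_idPr (leqW km)) (minn_idPr (leqW lm)).
Qed.

Variables (N : nat) (s : nat -> R) (n : nat) (t : nat -> R).
Hypotheses (sP : discretization T N s) (tP : discretization T n t).
Hypothesis st : refines N s n t.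

Definition step_fun (c : nat -> R) (u : R) : R :=
  \sum_(i < n) c i * \1_(`]t i, t i.+1]) u.

Lemma discretization_lt j k : (j <= N)%N -> (k <= N)%N -> (s j < s k) = (j < k)%N.
Proof.
move=> jN kN; apply/idP/idP => [|jk].
  by apply: contraTT; rewrite -leqNgt -leNgt => kj; exact: (discretization_homo sP kj).
have /lt_le_trans := (let: And3 _ _ h := sP in h) j (leq_trans jk kN).
by apply; exact: (discretization_homo sP).
Qed.

Lemma discretization_le j k : (j <= N)%N -> (k <= N)%N -> (s j <= s k) = (j <= k)%N.
Proof. by move=> jN kN; rewrite leNgt discretization_lt// -leqNgt. Qed.

(** A coarse increment is the telescoped sum of the fine increments inside it. Cells are open on the
    left, so the value on a fine cell is read at its right end; the left end may belong to the
    preceding coarse cell. *)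
Lemma step_fun_sum (c : nat -> R) (f : R -> R) :
  \sum_(i < n) c i * (f (t i.+1) - f (t i)) =
  \sum_(j < N) step_fun c (s j.+1) * (f (s j.+1) - f (s j)).
Proof.
under [RHS]eq_bigr do rewrite mulr_suml.
rewrite exchange_big/=; apply: eq_bigr => i _.
under eq_bigr do rewrite -mulrA; rewrite -mulr_sumr; congr (_ * _).
have [k kN sk] := st (ltnW (ltn_ord i)); have [l lN sl] := st (ltn_ord i).
have kl : (k <= l)%N.
  by rewrite -discretization_le// sk sl (discretization_homo tP).
transitivity (\sum_(j < N) (k <= j < l)%N%:R * (f (s j.+1) - f (s j))).
  by rewrite (telescope_sum_indicator (f \o s))// !(minn_idPr _)//= sk sl.
apply: eq_bigr => j _; congr (_ * _).
rewrite indicE mem_setE in_itv/= -sk -sl discretization_lt//.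
by rewrite discretization_le.
Qed.

(** Take the last coarse point not after [s j]. The next coarse point is itself a fine point after
    [s j], hence not before [s j.+1]. *)
Lemma refines_itv j : (j < N)%N -> exists i, [/\ (i < n)%N, t i <= s j,
  s j.+1 <= t i.+1 &
  forall c u, s j < u -> u <= s j.+1 -> step_fun c u = c i].
Proof.
move=> jN; have [s0 sN _] := sP; have [t0 tn _] := tP.
have [i [ilt ti tSi]] : exists i, [/\ (i < n)%N, t i <= s j & s j < t i.+1].
  have : s j < t n by rewrite tn -sN discretization_lt// ltnW.
  have : t 0%N <= s j by rewrite t0 -s0 discretization_le// ltnW.
  elim: (n) => [|m IH] h0 hm; first by rewrite ltNge h0 in hm.
  have [tm|tm] := leP (t m) (s j); first by exists m.
  by have [i [? ? ?]] := IH h0 tm; exists i; split => //; exact: ltnW.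
have tS : s j.+1 <= t i.+1.
  have [k kN sk] := st ilt; move: tSi; rewrite -sk discretization_lt//; last exact: ltnW.
  by move=> jk; rewrite discretization_le.
exists i; split => // c u ju uj.
rewrite /step_fun (bigD1 (Ordinal ilt))//= big1 ?addr0.
  by rewrite indicE mem_setE in_itv/= (le_lt_trans ti ju) (le_trans uj tS) mulr1.
move=> k ki; rewrite indicE mem_setE in_itv/=.
have [tk|] := ltP (t k) u; last by rewrite mulr0.
have [uk|] := leP u (t k.+1); last by rewrite mulr0.
have h a b : (a <= n)%N -> (b <= n)%N -> t a < t b -> (a < b)%N.
  move=> an bn; apply: contraTT; rewrite -leqNgt -leNgt => kj.
  exact: (discretization_homo tP kj).
have h1 : (k < i.+1)%N.
  by apply: h => //; [exact: ltnW|rewrite (lt_le_trans tk)// (le_trans uj)].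
have h2 : (i < k.+1)%N.
  by apply: h => //; [exact: ltnW|rewrite (le_lt_trans ti)// (lt_le_trans ju)].
by case/eqP: ki; apply/val_inj/eqP; rewrite /= eqn_leq -ltnS h1 -ltnS h2.
Qed.
End refinement.

(** Besides the points of both grids, those of the uniform grid with [k.+1] cells are included; each
    resulting cell lies in a uniform one, which bounds its length. *)
Lemma exists_refinement (R : realType) (T : R) (n m : nat) (t t' : nat -> R)
    (k : nat) : 0 < T -> discretization T n t -> discretization T m t' ->
  exists N s, [/\ discretization T N s, refines N s n t, refines N s m t' &
    forall j, (j < N)%N -> s j.+1 - s j <= T / k.+1%:R].
Proof.
move=> T0 tP tP'.
pose grid (i : nat) : R := T * (i%:R / k.+1%:R).
have gridP : discretization T k.+1 grid.
  split; rewrite /grid ?mul0r ?mulr0// ?divff ?mulr1//.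
  by move=> i ik; rewrite ltr_pM2l// ltr_pM2r ?invr_gt0// ltr_nat.
pose pts n (t : nat -> R) := [seq t i | i <- iota 0 n.+1].
have ptsP n' u x : discretization T n' u -> x \in pts n' u -> 0 <= x <= T.
  move=> uP /mapP[i]; rewrite mem_iota add0n ltnS => /andP[_ ni] ->.
  exact: discretization_itv uP _ ni.
have mem_pts n' u i : (i <= n')%N -> u i \in pts n' u.
  by move=> ni; apply/mapP; exists i => //; rewrite mem_iota add0n ltnS.
have [|||N [s [sP ls]]] :=
    @discretization_of_seq R T (pts n t ++ pts m t' ++ pts k.+1 grid).
- by move=> x; rewrite !mem_cat => /or3P[]; exact: ptsP.
- by case: tP => <- _ _; rewrite mem_cat mem_pts.
- by case: tP => _ tn _; rewrite -{1}tn mem_cat mem_pts.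
have rg : refines N s k.+1 grid.
  by move=> i ik; apply: ls; rewrite !mem_cat mem_pts ?orbT.
exists N, s; split => //.
- by move=> i ni; apply: ls; rewrite mem_cat mem_pts.
- by move=> i ni; apply: ls; rewrite !mem_cat mem_pts ?orbT.
- move=> j jN; have [i [ik gi gS _]] := refines_itv sP gridP rg jN.
  rewrite (le_trans (lerB gS gi))// /grid -mulrBr -mulrBl -natrB// subSnn.
  by rewrite mul1r.
Qed.

Section progressive.
Context d (Omega : measurableType d) (R : realType).
Variables (F : R -> set (set Omega)) (T : R) (X : R -> Omega -> R).
Hypotheses (filF : filtration F) (X_prog : progressively_measurable F T X).

Lemma progressive_adapted t : 0 <= t <= T -> sub_measurable (F t) (X t).
Proof.
move=> tT; have t0 : 0 <= t by case/andP: tT.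
apply/(sub_measurableP (filtration_sigma filF t0)).
apply: (@measurable_comp _ _ _ _ _ _ (`[0, t] `*` setT)
  (fun z : R * g_sigma_algebraType (F t) => X z.1 z.2) setT
  (fun w : g_sigma_algebraType (F t) => (t, w))) => //.
- by apply: measurableX => //; exact: measurable_itv.
- by move=> _ [w _ <-]; split => //=; rewrite in_itv/= t0 lexx.
- exact: X_prog.
- exact: measurable_fun_pair.
Qed.

(** Progressive measurability at the final time gives the joint measurability needed to exchange
    time integral and expectation by Tonelli. *)
Lemma progressive_joint : 0 <= T -> 
  measurable_fun (`[0, T] `*` setT) (fun z : R * Omega => X z.1 z.2).
Proof.
move=> T0; apply: (@measurable_comp _ _ _ _ _ _ (`[0, T] `*` setT)
  (fun z : R * g_sigma_algebraType (F T) => X z.1 z.2) _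
  (fun z : R * Omega => (z.1, z.2 : g_sigma_algebraType (F T)))) => //.
- by apply: measurableX => //; exact: measurable_itv.
- by move=> _ [[u w] [/= uT _] <-].
- by apply: X_prog; rewrite T0 lexx.
- apply: measurable_funTS; apply: measurable_fun_pair => //=.
  move=> _ B mB; rewrite setTI.
  have FB : measurable (B : set Omega).
    apply: (filtration_measurable filF T0).
    by move: mB; rewrite /measurable/= (sigma_algebra_id (filtration_sigma filF T0)).
  by have := @measurable_snd _ _ R Omega measurableT B FB; rewrite setTI.
Qed.
End progressive.

Lemma sqr_le_powR (R : realType) (z eta r : R) : 0 < eta -> 2 <= r ->
  z ^+ 2 <= eta ^+ 2 + eta `^ (2 - r) * `|z| `^ r.
Proof.
move=> eta0 r2; rewrite -(real_normK (num_real z)).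
have [ze|ez] := leP `|z| eta.
  rewrite ler_wpDr ?mulr_ge0 ?powR_ge0//.
  by rewrite ler_sqr ?nnegrE ?(ltW eta0).
rewrite ler_wpDl ?sqr_ge0//.
have z0 : 0 < `|z| := lt_trans eta0 ez.
have -> : `|z| `^ r = `|z| `^ (r - 2) * `|z| ^+ 2.
  by rewrite -powR_mulrn// -powRD ?subrK// (gt_eqF z0) implybT.
rewrite mulrA ler_peMl ?sqr_ge0//.
rewrite (_ : 2 - r = - (r - 2)); last by rewrite opprB.
rewrite powRN mulrC ler_pdivlMr ?powR_gt0// mul1r.
by rewrite powR_le_mono ?(ltW eta0) ?(ltW ez)//; lra.
Qed.

(** This plays the part of Jensen's inequality: splitting at the level [eta] of the L^r bound gives
    the L^2 bound up to a factor 2. *)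
Lemma integral_sqr_le (R : realType) d (Omega : measurableType d)
    (P : probability Omega R) (Z : Omega -> R) (eta r : R) :
  0 < eta -> 2 <= r -> measurable_fun setT Z ->
  (\int[P]_w (`|Z w| `^ r)%:E <= (eta `^ r)%:E)%E ->
  (\int[P]_w (Z w ^+ 2)%:E <= (2 * eta ^+ 2)%:E)%E.
Proof.
move=> eta0 r2 mZ Zr.
have mZr : measurable_fun setT (fun w => `|Z w| `^ r).
  by apply: (measurableT_comp (measurable_powR _)); exact: measurableT_comp.
have e0 : 0 <= eta `^ (2 - r) := powR_ge0 _ _.
apply: (@le_trans _ _ (\int[P]_w (eta ^+ 2 + eta `^ (2 - r) * `|Z w| `^ r)%:E)%E).
  by apply: le_integral_EFin => w; [exact: sqr_ge0|exact: sqr_le_powR].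
rewrite (ge0_integralD_EFin P (f := fun=> eta ^+ 2))//; first last.
- by move=> w; rewrite mulr_ge0 ?powR_ge0.
- by move=> _; exact: sqr_ge0.
- exact: measurable_funM.
rewrite (ge0_integralZ_EFin P e0)// integral_cst// [X in (_ * X)%E]probability_setT.
rewrite mule1.
rewrite mulr_natl mulr2n EFinD leeD2l//.
apply: (@le_trans _ _ ((eta `^ (2 - r))%:E * (eta `^ r)%:E)%E).
  by rewrite lee_wpmul2l// lee_fin.
rewrite -EFinM lee_fin.
by rewrite -powRD ?subrK ?powR_mulrn ?(ltW eta0)// (gt_eqF eta0) implybT.
Qed.

Section quadrature_L2.
Context d (Omega : measurableType d) (R : realType) (P : probability Omega R).
Variables (F : R -> set (set Omega)) (W : R -> Omega -> R) (T r L rho : R).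
Variable X : R -> Omega -> R.
Hypotheses (filF : filtration F) (T0 : 0 < T).
Hypotheses (r2 : 2 <= r) (rho0 : 0 <= rho) (L0 : 0 <= L).
Hypothesis X_prog : progressively_measurable F T X.
Hypothesis X_holder : forall t z, 0 <= t <= T -> 0 <= z <= T ->
  (\int[P]_w (`|X t w - X z w| `^ r)%:E <= ((L * `|t - z| `^ rho) `^ r)%:E)%E.

Lemma elem_fun_step (H : elementary_process F T) u w :
  elem_fun H u w = step_fun (elem_size H) (elem_time H) (elem_coef H ^~ w) u.
Proof. by []. Qed.

Lemma elem_coef_measurable (H : elementary_process F T) i :
  (i < elem_size H)%N -> measurable_fun setT (elem_coef H i).
Proof.
move=> iH; have /andP[h0 _] := discretization_itv (elem_timeP H) (ltnW iH).
by apply: (adapted_measurable filF h0); exact: elem_coef_meas.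
Qed.

Lemma X_measurable t : 0 <= t <= T -> measurable_fun setT (X t).
Proof.
move=> tT; have /andP[t0 _] := tT.
by apply: (adapted_measurable filF t0); exact: (progressive_adapted filF X_prog).
Qed.

Lemma elem_fun_joint (H : elementary_process F T) :
  measurable_fun setT (fun z : R * Omega => elem_fun H z.1 z.2).
Proof.
rewrite /elem_fun; apply: measurable_sum => i; apply: measurable_funM.
  by apply: measurableT_comp (@measurable_snd _ _ R Omega); exact: elem_coef_measurable.
apply: (measurableT_comp (f := \1_(`]elem_time H i, elem_time H i.+1]) : R -> R)) => //.
Qed.

(** Cutting the squared error off outside [0, T] lets Tonelli run over the whole line times [Omega];
    [e] below is its expectation at a given time. *)
Let errH (H : elementary_process F T) (z : R * Omega) : \bar R :=
  (((fun z => ((elem_fun H z.1 z.2 - X z.1 z.2) ^+ 2)%:E) \_ (`[0, T] `*` setT)) z).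

Let errH_ge0 H z : (0 <= errH H z)%E.
Proof. by rewrite /errH patchE; case: ifPn => // _; rewrite lee_fin sqr_ge0. Qed.

Let measurable_errH H : measurable_fun setT (errH H).
Proof.
have mD : measurable (`[0, T] `*` [set: Omega] : set (R * Omega)).
  by apply: measurableX => //; exact: measurable_itv.
apply/(measurable_restrictT _ mD)/measurable_EFinP/measurable_funX.
apply: measurable_funB; first by apply: measurable_funTS; exact: elem_fun_joint.
by apply: progressive_joint filF X_prog _; exact: ltW.
Qed.

Let e H u : \bar R := (\int[P]_w errH H (u, w))%E.

Let e_itv H u : 0 <= u <= T ->
  e H u = (\int[P]_w ((elem_fun H u w - X u w) ^+ 2)%:E)%E.
Proof.
move=> uT; apply: eq_integral => w _; rewrite /errH patchE mem_set//.
Qed.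

Let errH_total H :
  (\int[P]_w \int[lebesgue_measure]_(t in `[0%R, T])
        (((elem_fun H t w - X t w) ^+ 2)%:E) =
   \int[lebesgue_measure]_u e H u)%E.
Proof.
rewrite /e (@fubini_tonelli _ _ (measurableTypeR R) Omega R (@lebesgue_measure R)
  P (errH H)); last 2 first.
- exact: measurable_errH.
- exact: errH_ge0.
apply: eq_integral => w _.
rewrite integral_mkcond; apply: eq_integral => u _.
rewrite /errH !patchE; congr (if _ then _ else _).
by apply/idP/idP; rewrite !inE => //= -[].
Qed.

Let measurable_e H : measurable_fun [set: measurableTypeR R] (e H).
Proof.
exact: (@measurable_fun_fubini_tonelli_F _ _ (measurableTypeR R) Omega R P
  (errH H) (@measurable_errH H) (errH_ge0 H)).
Qed.

Let e_ge0 H u : (0 <= e H u)%E.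
Proof. by apply: integral_ge0 => w _; exact: errH_ge0. Qed.

Variables (H : elementary_process F T) (N : nat) (s : nat -> R).
Hypotheses (sP : discretization T N s).
Hypothesis sH : refines N s (elem_size H) (elem_time H).
Variables (eta eps : R).
Hypotheses (eta0 : 0 < eta).
Hypothesis s_eta : forall j, (j < N)%N -> L * (s j.+1 - s j) `^ rho <= eta.
Hypothesis H_eps : (\int[P]_w \int[lebesgue_measure]_(t in `[0%R, T])
        (((elem_fun H t w - X t w) ^+ 2)%:E) <= eps%:E)%E.

Let Y j w := elem_fun H (s j.+1) w - X (s j) w.
(** Bound for the second moment of [Y j] obtained by passing through [X u]: twice the error of [H]
    at u, plus twice the bound 2 eta^2 for moving [X] from u to the left end of the cell. *)
Let g u : \bar R := (2%:E * e H u + (4 * eta ^+ 2)%:E)%E.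
Let yI (j : nat) := (\int[lebesgue_measure]_(u in `]s j, s j.+1]) g u)%E.

Let g_ge0 u : (0 <= g u)%E.
Proof. by rewrite adde_ge0 ?mule_ge0// lee_fin mulr_ge0// sqr_ge0. Qed.

Let measurable_g : measurable_fun [set: measurableTypeR R] g.
Proof. by apply: emeasurable_funD => //; apply: emeasurable_funM. Qed.

Let sum_yI m : (m <= N)%N ->
  (\sum_(j < m) yI j = \int[lebesgue_measure]_(u in `]s 0%N, s m]) g u)%E.
Proof.
elim: m => [|m IH] mN; first by rewrite big_ord0 set_itvoc0 integral_set0.
rewrite big_ord_recr/= IH ?(ltnW mN)//.
have mitv a b : measurable (`]a, b] : set (measurableTypeR R)).
  exact: measurable_itv.
rewrite -ge0_integral_setU//=.
- rewrite -itv_bndbnd_setU//; rewrite bnd_simp.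
    exact: (discretization_homo sP (leq0n _) (ltnW mN)).
  exact: (discretization_homo sP (leqnSn _) mN).
- exact: measurable_funTS.
- apply/disj_setPS => u [] /=; rewrite !in_itv/= => /andP[_ um] /andP[].
  by rewrite ltNge um.
Qed.

Let sum_yI_le : (\sum_(j < N) yI j <= (2 * eps + 4 * eta ^+ 2 * T)%:E)%E.
Proof.
rewrite sum_yI//; have [-> -> _] := sP.
have mitv : measurable (`]0, T] : set (measurableTypeR R)) by exact: measurable_itv.
rewrite ge0_integralD//=; last 3 first.
- by move=> u _; rewrite mule_ge0.
- by apply: emeasurable_funM => //; exact: measurable_funTS.
- by move=> u _; rewrite lee_fin mulr_ge0// sqr_ge0.
rewrite [leRHS]EFinD leeD//.
- rewrite ge0_integralZl_EFin//; last exact: measurable_funTS.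
  rewrite [leRHS]EFinM lee_wpmul2l//; apply: le_trans H_eps; rewrite errH_total.
  by apply: ge0_subset_integral => //; exact: measurable_e.
- rewrite integral_cst//= lebesgue_measure_itv/= lte_fin T0 -EFinD subr0.
  by rewrite -EFinM.
Qed.

Let sT j : (j <= N)%N -> 0 <= s j <= T.
Proof. exact: (discretization_itv sP). Qed.

Let s_lt j : (j < N)%N -> s j < s j.+1.
Proof. by case: sP => _ _; exact. Qed.

Let measurable_Y j : (j < N)%N -> measurable_fun setT (Y j).
Proof.
move=> jN; apply: measurable_funB; last exact/X_measurable/sT/ltnW.
have [i [iH _ _ stepE]] := refines_itv sP (elem_timeP H) sH jN.
have HE : elem_fun H (s j.+1) = elem_coef H i.
  by apply/funext => w; rewrite elem_fun_step (stepE _ _ (s_lt jN) (lexx _)).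
by have := elem_coef_measurable iH; rewrite -HE.
Qed.

(** Although [H] is read at the right end of the cell, its value there is a coefficient already
    known at a coarse time not after [s j]. *)
Let Y_sub_measurable j : (j < N)%N -> sub_measurable (F (s j)) (Y j).
Proof.
move=> jN; have sj := sT (ltnW jN); have /andP[sj0 _] := sj.
have sF := filtration_sigma filF sj0.
apply/(sub_measurableP sF); apply: measurable_funB; apply/(sub_measurableP sF).
  have [i [iH ti _ stepE]] := refines_itv sP (elem_timeP H) sH jN.
  have HE : elem_fun H (s j.+1) = elem_coef H i.
    by apply/funext => w; rewrite elem_fun_step (stepE _ _ (s_lt jN) (lexx _)).
  have /andP[ti0 _] := discretization_itv (elem_timeP H) (ltnW iH).
  have := sub_measurable_homo filF ti0 ti (elem_coef_meas iH).
  by rewrite -HE.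
by have := progressive_adapted filF X_prog sj.
Qed.

Let elem_fun_const j u w : (j < N)%N -> s j < u -> u <= s j.+1 ->
  elem_fun H (s j.+1) w = elem_fun H u w.
Proof.
move=> jN ju uj.
have [i [_ _ _ stepE]] := refines_itv sP (elem_timeP H) sH jN.
by rewrite !elem_fun_step !stepE// s_lt.
Qed.

(** [H] is constant on the cell, so [Y j] can be split through any time u in it. Integrating over u
    then turns closeness in L^2 of time into a bound at a grid point. *)
Let Y_le j u : (j < N)%N -> s j < u -> u <= s j.+1 ->
  (\int[P]_w (`|Y j w| `^ 2)%:E <= g u)%E.
Proof.
move=> jN ju uj; have sj := sT (ltnW jN); have sj1 := sT jN.
have uT : 0 <= u <= T.
  by move: sj sj1 => /andP[? _] /andP[_ ?]; rewrite (le_trans _ (ltW ju))//=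
    (le_trans uj).
have mX := X_measurable uT.
have mXs := X_measurable sj.
have mH : measurable_fun setT (fun w => elem_fun H u w).
  have -> : (fun w => elem_fun H u w) = Y j \+ X (s j).
    by apply/funext => w; rewrite -(elem_fun_const _ jN ju uj) /Y /= subrK.
  by apply: measurable_funD => //; exact: measurable_Y.
apply: (@le_trans _ _ (\int[P]_w (2 * (elem_fun H u w - X u w) ^+ 2 +
    2 * (X u w - X (s j) w) ^+ 2)%:E)%E).
  apply: le_integral_EFin => w; first exact: powR_ge0.
  rewrite powR_mulrn// real_normK ?num_real// /Y (elem_fun_const _ jN ju uj).
  have : 0 <= (elem_fun H u w - X u w - (X u w - X (s j) w)) ^+ 2 by exact: sqr_ge0.
  lra.
rewrite ge0_integralD_EFin; first last.
- by move=> w; rewrite mulr_ge0 ?sqr_ge0.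
- by move=> w; rewrite mulr_ge0 ?sqr_ge0.
- by apply: measurable_funM => //; apply: measurable_funX; exact: measurable_funB.
- by apply: measurable_funM => //; apply: measurable_funX; exact: measurable_funB.
rewrite !ge0_integralZ_EFin//; first last.
- by move=> w; exact: sqr_ge0.
- by apply: measurable_funX; exact: measurable_funB.
- by move=> w; exact: sqr_ge0.
- by apply: measurable_funX; exact: measurable_funB.
rewrite /g -(e_itv H uT) leeD2l//.
have -> : 4 * eta ^+ 2 = 2 * (2 * eta ^+ 2) by ring.
rewrite [leRHS]EFinM lee_wpmul2l//.
apply: (integral_sqr_le (r := r)) => //; first exact: measurable_funB.
apply: (le_trans (X_holder uT sj)); rewrite lee_fin.
apply: powR_le_mono; [exact: le_trans r2|by rewrite mulr_ge0 ?powR_ge0|].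
rewrite (le_trans _ (s_eta jN))// ler_wpM2l//.
by rewrite ger0_norm ?subr_ge0 ?(ltW ju)// powR_le_mono ?subr_ge0 ?(ltW ju)// lerB.
Qed.

Let yI_le j : (j < N)%N ->
  (\int[P]_w (`|Y j w| `^ 2)%:E * (s j.+1 - s j)%:E <= yI j)%E.
Proof.
move=> jN; have mitv : measurable (`]s j, s j.+1] : set (measurableTypeR R)).
  exact: measurable_itv.
have <- : (\int[lebesgue_measure]_(u in `]s j, s j.+1])
    (cst (\int[P]_w (`|Y j w| `^ 2)%:E) u) =
    \int[P]_w (`|Y j w| `^ 2)%:E * (s j.+1 - s j)%:E)%E.
  by rewrite integral_cst//= lebesgue_measure_itv/= lte_fin s_lt.
apply: ge0_le_integral => //.
- by move=> u _; apply: integral_ge0 => w _; rewrite lee_fin powR_ge0.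
- exact: measurable_funTS.
- by move=> u /=; rewrite in_itv/= => /andP[ju uj]; exact: Y_le.
Qed.

Variable K : R.
Hypotheses (K0 : 0 <= K).
Hypothesis HK : forall n t, discretization T n t ->
  forall (Y : nat -> Omega -> R) (y : nat -> R),
  (forall i, (i < n)%N -> sub_measurable (F (t i)) (Y i)) ->
  (forall i, (i < n)%N -> (\int[P]_w (`|Y i w| `^ 2)%:E <= (y i)%:E)%E) ->
  (\int[P]_w (`|\sum_(i < n) Y i w * (W (t i.+1) w - W (t i) w)| `^ 2)%:E <=
   (K * \sum_(i < n) y i * (t i.+1 - t i))%:E)%E.

Lemma elem_integral_quadrature_L2 :
  (\int[P]_w ((elem_integral W H w -
     \sum_(j < N) X (s j) w * (W (s j.+1) w - W (s j) w)) ^+ 2)%:E <=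
   (K * (2 * eps + 4 * eta ^+ 2 * T))%:E)%E.
Proof.
have yI0 j : (0 <= yI j)%E by apply: integral_ge0 => u _; exact: g_ge0.
have yI_fin j : (j < N)%N -> yI j \is a fin_num.
  move=> jN; rewrite ge0_fin_numE//.
  apply: le_lt_trans (ltry (2 * eps + 4 * eta ^+ 2 * T)).
  apply: le_trans sum_yI_le; rewrite (bigD1 (Ordinal jN))//= leeDl//.
  by apply: sume_ge0 => i _; exact: yI0.
(* [y j] is the mean of [g] over the cell, so its product with the cell length is again the integral
   of [g]. *)
pose y j := fine (yI j) / (s j.+1 - s j).
have yE : (\sum_(j < N) y j * (s j.+1 - s j))%:E = (\sum_(j < N) yI j)%E.
  rewrite -sumEFin; apply: eq_bigr => j _.
  by rewrite /y divfK ?fineK ?yI_fin// subr_eq0 gt_eqF// s_lt.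
have := @HK N s sP Y y Y_sub_measurable.
have Yy j : (j < N)%N -> (\int[P]_w (`|Y j w| `^ 2)%:E <= (y j)%:E)%E.
  move=> jN; rewrite /y EFinM lee_pdivlMr ?subr_gt0 ?s_lt// fineK ?yI_fin//.
  exact: yI_le.
move=> /(_ Yy) h; apply: (le_trans _ (le_trans h _)); last first.
  rewrite EFinM yE [leRHS]EFinM; apply: lee_wpmul2l; first by rewrite lee_fin.
  exact: sum_yI_le.
apply: le_integral_EFin => w; first exact: sqr_ge0.
rewrite powR_mulrn// real_normK ?num_real//.
rewrite /elem_integral (step_fun_sum sP (elem_timeP H) sH (elem_coef H ^~ w) (W ^~ w)).
rewrite -sumrB le_eqVlt; apply/orP; left; apply/eqP; congr (_ ^+ 2).
by apply: eq_bigr => j _; rewrite /Y elem_fun_step mulrBl.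
Qed.
End quadrature_L2.

(* Integrated, this carries a bound on [E|x|^r] over to an [L^2] limit [y] of [x],
   up to the factor [2^r]. *)
Lemma powR_truncation_le (R : realType) (x y M r : R) : 2 <= r -> `|y| <= M ->
  `|y| `^ r <= 2 `^ r * `|x| `^ r + 4 * M `^ (r - 2) * (x - y) ^+ 2.
Proof.
move=> r2 yM; have r0 : 0 <= r by lra.
have h0 : 0 <= 4 * M `^ (r - 2) * (x - y) ^+ 2.
  by apply: mulr_ge0 (sqr_ge0 _); rewrite mulr_ge0 ?powR_ge0.
have [yx|xy] := leP `|y| (2 * `|x|).
  rewrite ler_wpDr//.
  by rewrite -powRM// powR_le_mono.
rewrite ler_wpDl ?mulr_ge0 ?powR_ge0//.
have y0 : 0 < `|y| by rewrite (le_lt_trans _ xy)// mulr_ge0.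
have -> : `|y| `^ r = `|y| `^ (r - 2) * `|y| ^+ 2.
  by rewrite -powR_mulrn// -powRD ?subrK// (gt_eqF y0) implybT.
have h1 : `|y| `^ (r - 2) <= M `^ (r - 2) by rewrite powR_le_mono// subr_ge0.
have h2 : `|y| <= 2 * `|x - y|.
  have := ler_normD x (y - x); rewrite (addrC x) subrK (distrC y); lra.
have h3 : `|y| ^+ 2 <= 4 * (x - y) ^+ 2.
  rewrite -(real_normK (num_real (x - y))).
  have -> : 4 * `|x - y| ^+ 2 = (2 * `|x - y|) ^+ 2 by ring.
  by rewrite ler_sqr ?nnegrE.
have -> : 4 * M `^ (r - 2) * (x - y) ^+ 2 = M `^ (r - 2) * (4 * (x - y) ^+ 2) by ring.
by rewrite ler_pM ?powR_ge0 ?sqr_ge0.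
Qed.

(** Monotone convergence along the sets where |y| <= M. The level M is thus fixed before an L^2
    approximation is chosen, although the factor M^(r-2) in the truncation inequality may grow with
    M. *)
Lemma le_integral_trunc (R : realType) d (Omega : measurableType d)
    (mu : {measure set Omega -> \bar R}) (f y : Omega -> R) (B : \bar R) :
  measurable_fun setT f -> measurable_fun setT y -> (forall w, 0 <= f w) ->
  (forall M : nat,
    \int[mu]_(w in [set w | (`|y w| <= M%:R)%R]) (f w)%:E <= B)%E ->
  (\int[mu]_w (f w)%:E <= B)%E.
Proof.
move=> mf my f0 H.
pose S (M : nat) := [set w | `|y w| <= M%:R].
have mS M : measurable (S M).
  have -> : S M = setT `&` (fun w => `|y w|) @^-1` `]-oo, M%:R].
    by rewrite setTI; apply/seteqP; split=> w /=; rewrite in_itv.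
  have my' : measurable_fun setT (fun w => `|y w|) by exact: measurableT_comp.
  exact: my'.
have SE : \bigcup_M S M = setT.
  rewrite -subTset => w _; exists (Num.truncn `|y w|).+1 => //.
  by rewrite /S/= ltW// truncnS_gt.
have := @ge0_nondecreasing_set_cvg_integral _ _ _ S (fun w => (f w)%:E) mu.
rewrite SE => /(_ _ mS) cvg.
rewrite -(cvg_lim _ (cvg _ _ _))//.
- apply: lime_le; last by apply: nearW => M; exact: H.
  apply/cvg_ex; eexists; apply: cvg.
  + apply/nondecreasing_seqP => M; rewrite subsetEset => w; rewrite /S/= => /le_trans.
    by apply; rewrite ler_nat.
  + by move=> M; apply: measurable_funTS; exact/measurable_EFinP.
  + by move=> M w _; rewrite lee_fin.
- apply/nondecreasing_seqP => M; rewrite subsetEset => w; rewrite /S/= => /le_trans.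
  by apply; rewrite ler_nat.
- by move=> M; apply: measurable_funTS; exact/measurable_EFinP.
- by move=> M w _; rewrite lee_fin.
Qed.

Lemma cvge0_near (R : realType) (u : nat -> \bar R) (eps : R) : 0 < eps ->
  u @ \oo --> 0%E -> \forall k \near \oo, (u k <= eps%:E)%E.
Proof.
move=> e0 u0; have e0' : (0 < eps%:E)%E by rewrite lte_fin.
have : \forall k \near \oo, (u k < eps%:E)%E by exact: u0 _ (open_ereal_lt' e0').
by apply: filterS => k /ltW.
Qed.

Section ito_error.
Context d (Omega : measurableType d) (R : realType) (P : probability Omega R).
Variables (F : R -> set (set Omega)) (W : R -> Omega -> R) (T r L rho : R).
Variable X : R -> Omega -> R.
Hypotheses (filF : filtration F) (wW : wiener_process P F W) (T0 : 0 < T).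
Hypotheses (r2 : 2 <= r) (rho0 : 0 < rho) (L0 : 0 <= L).
Hypothesis X_prog : progressively_measurable F T X.
Hypothesis X_holder : forall t z, 0 <= t <= T -> 0 <= z <= T ->
  (\int[P]_w (`|X t w - X z w| `^ r)%:E <= ((L * `|t - z| `^ rho) `^ r)%:E)%E.

(** The conclusion of [wiener_sum_moment] on a fixed space, kept as a hypothesis so that its
    constant can be chosen before that space. *)
Definition wiener_sum_bound (p K : R) := forall n t, discretization T n t ->
  forall (Y : nat -> Omega -> R) (y : nat -> R),
  (forall i, (i < n)%N -> sub_measurable (F (t i)) (Y i)) ->
  (forall i, (i < n)%N -> (\int[P]_w (`|Y i w| `^ p)%:E <= (y i)%:E)%E) ->
  (\int[P]_w (`|\sum_(i < n) Y i w * (W (t i.+1) w - W (t i) w)| `^ p)%:E <=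
   (K * \sum_(i < n) y i * (t i.+1 - t i))%:E)%E.

Variables (K2 Kr : R) (K20 : 0 <= K2).
Hypotheses (HK2 : wiener_sum_bound 2 K2) (HKr : wiener_sum_bound r Kr).
Variables (I : Omega -> R) (HI : ito_integral P F T W X I).
Variables (n : nat) (t : nat -> R) (tP : discretization T n t).

Local Notation quad N s w :=
  (\sum_(j < N) X (s j) w * (W (s j.+1) w - W (s j) w)).

Lemma weighted_sum_measurable N s (Y : nat -> Omega -> R) : discretization T N s ->
  (forall j, (j < N)%N -> measurable_fun setT (Y j)) ->
  measurable_fun setT (fun w => \sum_(j < N) Y j w * (W (s j.+1) w - W (s j) w)).
Proof.
move=> sP mY; apply: measurable_sum => j; apply: measurable_funM.
  exact: mY.
have /andP[sj0 _] := discretization_itv sP (ltn_ord j).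
have /andP[sj _] := discretization_itv sP (ltnW (ltn_ord j)).
by apply: measurable_funB; exact: (wiener_measurable filF wW).
Qed.

Lemma quad_measurable N s : discretization T N s ->
  measurable_fun setT (fun w => quad N s w).
Proof.
move=> sP; apply: (weighted_sum_measurable (Y := X \o s)) => // j jN.
exact/(X_measurable filF X_prog)/(discretization_itv sP)/ltnW.
Qed.

Lemma elem_integral_measurable (H : elementary_process F T) :
  measurable_fun setT (elem_integral W H).
Proof.
by apply: weighted_sum_measurable (elem_timeP H) _ => j; exact: elem_coef_measurable.
Qed.

Lemma ito_integral_approx (eps : R) : 0 < eps ->
  exists N s, [/\ discretization T N s, refines N s n t &
    (\int[P]_w ((quad N s w - I w) ^+ 2)%:E <= eps%:E)%E].
Proof.
move=> eps0; have [mI [H [HX HW]]] := HI.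
(* [C e] is the total error: 2 K2 (2 e + 4 e T) between the quadrature and the elementary integral,
   and 2 e between the latter and [I]. *)
pose C := 4 * K2 * (1 + 2 * T) + 2.
have C0 : 0 < C by rewrite ltr_wpDl// !mulr_ge0// addr_ge0// mulr_ge0// ltW.
pose e := eps / C; have e0 : 0 < e by rewrite divr_gt0.
pose eta := Num.sqrt e; have eta0 : 0 < eta by rewrite sqrtr_gt0.
have etaE : eta ^+ 2 = e by rewrite sqr_sqrtr ?ltW.
(* On cells of length at most [h] the Holder bound is at most [eta]; L + 1 is the divisor because L
   may be 0. *)
pose h := (eta / (L + 1)) `^ rho^-1.
have L1 : 0 < L + 1 by rewrite ltr_wpDl.
have h0 : 0 < h by apply: powR_gt0; rewrite divr_gt0.
have [k [kX kW kh]] : exists k, [/\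
    (\int[P]_w \int[lebesgue_measure]_(t in `[0%R, T])
        (((elem_fun (H k) t w - X t w) ^+ 2)%:E) <= e%:E)%E,
    (\int[P]_w (((elem_integral W (H k) w - I w) ^+ 2)%:E) <= e%:E)%E
    & T / k.+1%:R <= h].
  have hk : \forall k \near \oo, T / k.+1%:R <= h.
    exists (Num.truncn (T / h)) => // k /= kk.
    rewrite ler_pdivrMr ?ltr0n// mulrC -ler_pdivrMr//.
    by rewrite ltW// (lt_le_trans (truncnS_gt _))// ler_nat ltnS.
  have [k [? [? ?]]] := filter_ex (filterI (cvge0_near e0 HX)
    (filterI (cvge0_near e0 HW) hk)).
  by exists k.
have [N [s [sP st sH sk]]] := exists_refinement k T0 tP (elem_timeP (H k)).
exists N, s; split => //.
have s_eta j : (j < N)%N -> L * (s j.+1 - s j) `^ rho <= eta.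
  move=> jN; have ds : 0 <= s j.+1 - s j.
    by rewrite subr_ge0 ltW//; case: sP => _ _; exact.
  apply: (@le_trans _ _ (L * h `^ rho)).
    rewrite ler_wpM2l// powR_le_mono ?(ltW rho0)//.
    exact: le_trans (sk _ jN) kh.
  rewrite -powRrM mulVf ?gt_eqF// powRr1; last by rewrite divr_ge0// ltW.
  by rewrite mulrA ler_pdivrMr// mulrC ler_wpM2l ?lerDl// ltW.
have A := elem_integral_quadrature_L2 filF T0 r2 (ltW rho0) L0 X_prog X_holder
  sP sH eta0 s_eta kX K20 HK2.
have mQ := quad_measurable sP; have mE := elem_integral_measurable (H k).
apply: (@le_trans _ _ (\int[P]_w (2 * (elem_integral W (H k) w - quad N s w) ^+ 2 +
    2 * (elem_integral W (H k) w - I w) ^+ 2)%:E)%E).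
  apply: le_integral_EFin => w; first exact: sqr_ge0.
  set a := elem_integral W (H k) w; set b := quad N s w.
  have : 0 <= (a - b + (a - I w)) ^+ 2 by exact: sqr_ge0.
  lra.
have m1 : measurable_fun setT (fun w => (elem_integral W (H k) w - quad N s w) ^+ 2).
  by apply: measurable_funX; exact: measurable_funB.
have m2 : measurable_fun setT (fun w => (elem_integral W (H k) w - I w) ^+ 2).
  by apply: measurable_funX; exact: measurable_funB.
rewrite ge0_integralD_EFin; first last.
- by move=> w; rewrite mulr_ge0 ?sqr_ge0.
- by move=> w; rewrite mulr_ge0 ?sqr_ge0.
- exact: measurable_funM.
- exact: measurable_funM.
rewrite !ge0_integralZ_EFin//; try by move=> w; exact: sqr_ge0.
apply: (@le_trans _ _ (2%:E * (K2 * (2 * e + 4 * eta ^+ 2 * T))%:E + 2%:E * e%:E)%E).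
  by rewrite leeD// lee_wpmul2l.
rewrite -!EFinM -EFinD lee_fin etaE /e.
have -> : eps = C * (eps / C) by rewrite mulrC divfK// gt_eqF.
set z := eps / C; rewrite /C mulrAC divff ?mul1r; last by rewrite gt_eqF.
rewrite le_eqVlt; apply/orP; left; apply/eqP; ring.
Qed.

(** The difference is a weighted sum of fine increments with weights X(s_j) - X(t_i), where s_j lies
    in the coarse cell starting at t_i. Only the coarse mesh enters the bound, so it survives
    refinement. *)
Lemma quad_refinement_error N s (a : R) : discretization T N s ->
  refines N s n t ->
  (forall i, (i < n)%N -> L * (t i.+1 - t i) `^ rho <= a) ->
  (\int[P]_w (`|quad N s w - quad n t w| `^ r)%:E <=
    (Kr * (a `^ r * T))%:E)%E.
Proof.
move=> sP st ta.
pose Z j w := X (s j) w - step_fun n t (fun i => X (t i) w) (s j.+1).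
have s_lt j : (j < N)%N -> s j < s j.+1 by case: sP => _ _; exact.
have ZP j : (j < N)%N -> exists i, [/\ (i < n)%N, t i <= s j, s j.+1 <= t i.+1 &
    Z j = X (s j) \- X (t i)].
  move=> jN; have [i [ni ti it stepE]] := refines_itv sP tP st jN.
  exists i; split => //; apply/funext => w.
  by rewrite /Z (stepE (fun i => X (t i) w))// s_lt.
have quadE w : quad N s w - quad n t w =
    \sum_(j < N) Z j w * (W (s j.+1) w - W (s j) w).
  rewrite (step_fun_sum sP tP st (fun i => X (t i) w) (W ^~ w)) -sumrB.
  by apply: eq_bigr => j _; rewrite mulrBl.
under eq_integral do rewrite quadE.
apply: le_trans (HKr sP (y := fun=> a `^ r) _ _) _.
- move=> j jN; have [i [ni ti _ ->]] := ZP _ jN.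
  have sj := discretization_itv sP (ltnW jN); have /andP[sj0 _] := sj.
  have tj := discretization_itv tP (ltnW ni); have /andP[tj0 _] := tj.
  have sF := filtration_sigma filF sj0; apply/(sub_measurableP sF).
  apply: measurable_funB; apply/(sub_measurableP sF).
    exact: (progressive_adapted filF X_prog).
  apply: (sub_measurable_homo filF tj0 ti).
  exact: (progressive_adapted filF X_prog).
- move=> j jN; have [i [ni ti it ->]] := ZP _ jN.
  have sj := discretization_itv sP (ltnW jN).
  have tj := discretization_itv tP (ltnW ni).
  apply: le_trans (X_holder sj tj) _; rewrite lee_fin.
  apply: powR_le_mono; [exact: le_trans r2|by rewrite mulr_ge0 ?powR_ge0|].
  rewrite (le_trans _ (ta _ ni))// ler_wpM2l// ger0_norm ?subr_ge0//.
  rewrite powR_le_mono ?subr_ge0 ?(ltW rho0)// lerD2r.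
  by rewrite (le_trans _ it)// ltW// s_lt.
by rewrite lee_fin -mulr_sumr (discretization_sum sP).
Qed.

Lemma ito_quadrature_error (a : R) :
  (forall i, (i < n)%N -> L * (t i.+1 - t i) `^ rho <= a) ->
  (\int[P]_w (`|I w - quad n t w| `^ r)%:E <=
    (2 `^ r * (Kr * (a `^ r * T)))%:E)%E.
Proof.
move=> ta; have [mI _] := HI; have mQ := quad_measurable tP.
have mp (f : Omega -> R) : measurable_fun setT f ->
    measurable_fun setT (fun w => `|f w| `^ r).
  by move=> mf; apply: (measurableT_comp (measurable_powR _)); exact: measurableT_comp.
have my : measurable_fun setT (fun w => I w - quad n t w) by exact: measurable_funB.
apply: (le_integral_trunc (y := fun w => I w - quad n t w)) => //; first exact: mp.
move=> M; apply/lee_addgt0Pr => e e0.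
pose c : R := 4 * M%:R `^ (r - 2).
have c0 : 0 <= c by rewrite mulr_ge0 ?powR_ge0.
(* With M fixed, the L^2 error is so small that [c] times it is at most [e]; the divisor is [c + 1]
   since [c] can vanish. *)
have [|N [s [sP st Qs]]] := @ito_integral_approx (e / (c + 1)).
  by rewrite divr_gt0// ltr_wpDl.
have mQs := quad_measurable sP.
have mx : measurable_fun setT (fun w => quad N s w - quad n t w) by exact: measurable_funB.
have mz : measurable_fun setT (fun w => (quad N s w - I w) ^+ 2).
  by apply: measurable_funX; exact: measurable_funB.
apply: (@le_trans _ _ (\int[P]_w (2 `^ r * `|quad N s w - quad n t w| `^ r +
    c * (quad N s w - I w) ^+ 2)%:E)%E).
  rewrite integral_mkcond; apply: ge0_le_integralT => w; rewrite patchE.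
    by case: ifP => // _; rewrite lee_fin powR_ge0.
  case: ifPn => [|_]; last first.
    by rewrite lee_fin addr_ge0//; apply: mulr_ge0; rewrite ?powR_ge0 ?sqr_ge0.
  rewrite inE /= => yM; rewrite lee_fin.
  have := powR_truncation_le (quad N s w - quad n t w) r2 yM.
  by rewrite -/c opprB addrA subrK.
rewrite ge0_integralD_EFin; first last.
- by move=> w; rewrite mulr_ge0 ?sqr_ge0.
- by move=> w; rewrite mulr_ge0 ?powR_ge0.
- exact: measurable_funM.
- by apply: measurable_funM => //; exact: mp.
rewrite (ge0_integralZ_EFin P (powR_ge0 _ _))//; last exact: mp.
rewrite (ge0_integralZ_EFin P c0)//; last by move=> w; exact: sqr_ge0.
rewrite leeD//.
  rewrite [leRHS]EFinM lee_wpmul2l ?lee_fin ?powR_ge0//.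
  exact: quad_refinement_error.
apply: (@le_trans _ _ (c%:E * (e / (c + 1))%:E)%E).
  by rewrite lee_wpmul2l ?lee_fin.
rewrite -EFinM lee_fin mulrA ler_pdivrMr ?ltr_wpDl// mulrC.
by rewrite ler_wpM2l ?(ltW e0)// lerDl.
Qed.
End ito_error.

(** * Increments of the disturbing functions *)

Section mean_value.
Context {R : realType}.

Lemma MVT_normr_le (f df : R -> R) (a b B : R) :
  (forall x, Num.min a b < x < Num.max a b -> is_derive x 1 f (df x)) ->
  {within `[Num.min a b, Num.max a b], continuous f} ->
  (forall x, Num.min a b <= x <= Num.max a b -> `|df x| <= B) ->
  `|f b - f a| <= B * `|b - a|.
Proof.
wlog ab : a b / a <= b => [H|].
  have /orP[ab|ba] := le_total a b; first exact: H.
  by rewrite distrC [X in _ <= _ * X]distrC; have := H b a ba; rewrite minC maxC.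
rewrite (min_idPl ab) (max_idPr ab) => fd fc dfB.
have fd' x : x \in `]a, b[%R -> is_derive x 1 f (df x).
  by rewrite in_itv/= => xab; exact: fd.
have [c cab ->] := @MVT_segment R f df a b ab fd' fc.
rewrite normrM ler_wpM2r//; apply: dfB.
by move: cab; rewrite in_itv.
Qed.

Lemma time_derivative_is_derive (T : R) (p pt : R -> R -> R) (t y : R) :
  is_time_derivative T p pt -> 0 < t < T -> is_derive t 1 (p ^~ y) (pt t y).
Proof.
move=> ppt /andP[t0 tT].
have tT' : 0 <= t <= T by rewrite !ltW.
have h : h^-1 *: (((p ^~ y) \o shift t) (h *: 1) - p t y) @[h --> 0^'] -->
    pt t y.
  have sh : (fun h : R => h + t) @ 0^' --> within `[0, T] (t^').
    move=> U; rewrite /within/= /dnbhs/within/= => /nbhs_ballP[e /= e0 eU].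
    apply/nbhs_ballP; exists (Num.min e (Num.min t (T - t))) => /=.
      by rewrite !lt_min e0 t0 subr_gt0 tT.
    move=> h; rewrite /ball/= sub0r normrN !lt_min => /and3P[he ht hT] h0.
    apply: eU.
    - by rewrite /ball/= opprD addrCA subrr addr0 normrN.
    - by apply/eqP => /(canRL (addrK _)); rewrite subrr; apply/eqP.
    - move: ht hT; rewrite !ltr_norml in_itv/= => /andP[? _] /andP[_ ?].
      by apply/andP; split; lra.
  have := cvg_comp _ _ sh (ppt t y tT').
  apply: cvg_trans; apply: near_eq_cvg; near=> h.
  by rewrite /= addrK mulrC [h *: 1]mulr1.
by apply: DeriveDef; [apply/cvg_ex; exists (pt t y)|exact/cvg_lim].
Unshelve. all: by end_near. Qed.

Lemma jointly_continuous_time (T : R) (p : R -> R -> R) (a b y : R) :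
  0 <= a -> b <= T -> jointly_continuous T p ->
  {within `[a, b], continuous (p ^~ y)}.
Proof.
move=> a0 bT /subspace_continuousP pc; apply/subspace_continuousP => x xab.
have xT : (`[0, T] `*` [set: R]) (x, y).
  split => //=; move: xab; rewrite /= !in_itv/= => /andP[ax xb].
  by rewrite (le_trans a0)// (le_trans xb).
apply: (cvg_comp (fun u => (u, y)) _ _ (pc (x, y) xT)).
move=> U; rewrite /within/= => -[[A B] [/= nA nB] AB].
apply: filterS nA => u Au uab; apply: (AB (u, y)).
  by split => //=; exact: nbhs_singleton.
split => //=; move: uab; rewrite /= !in_itv/= => /andP[au ub].
by rewrite (le_trans a0)// (le_trans ub).
Qed.
End mean_value.

Section disturbing_increments.
Context {R : realType}.
Implicit Types (p : R -> R -> R) (T s t y z h : R).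

Lemma abs_pow_le_powR y s : abs_pow y s <= `|y| `^ s.
Proof. by rewrite /abs_pow; case: ifP => // _; exact: powR_ge0. Qed.

(** A majorant of 1 + |z|^s for all z within |h| of y, written as a product of a function of y and a
    function of h: with y = W(t_i) and h the next increment, the factors are independent. *)
Definition growth s y h : R := 2 `^ s * ((1 + `|y| `^ s) * (1 + `|h| `^ s)).

Lemma abs_pow_le_growth s y z h : 0 <= s -> `|z| <= `|y| + `|h| ->
  1 + abs_pow z s <= growth s y h.
Proof.
move=> s0 zyh; apply: (@le_trans _ _ (1 + 2 `^ s * (`|y| `^ s + `|h| `^ s))).
  rewrite lerD2l (le_trans (abs_pow_le_powR _ _))//.
  by rewrite (le_trans _ (powRD_le _ _ _))// powR_le_mono.
have : 2 `^ 0 <= 2 `^ s :> R by rewrite ler_powR// ler1n.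
rewrite powRr0 => h2.
have := powR_ge0 `|y| s; have := powR_ge0 `|h| s => hh hy.
have : 0 <= 2 `^ s * (`|y| `^ s * `|h| `^ s) by rewrite !mulr_ge0// powR_ge0.
rewrite /growth; lra.
Qed.

Lemma growth_ge0 s y h : 0 <= growth s y h.
Proof. by rewrite /growth mulr_ge0 ?powR_ge0// mulr_ge0 ?addr_ge0 ?powR_ge0. Qed.

Lemma space_increment_le T p py t y y' B : is_space_derivative T p py ->
  0 <= t <= T -> (forall z, `|z - y| <= `|y' - y| -> `|py t z| <= B) ->
  `|p t y' - p t y| <= B * `|y' - y|.
Proof.
move=> ppy tT pyB.
have der z : is_derive z 1 (p t) (py t z) by exact: ppy.
apply: (MVT_normr_le (fun z _ => der z)).
- by apply: derivable_within_continuous => z _; have [] := der z.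
- move=> z; rewrite minElt maxElt.
  case: ltP => yy' /andP[? ?]; apply: pyB.
    by rewrite !ger0_norm; lra.
  by rewrite !ler0_norm; lra.
Qed.

(** The mean value theorem takes derivatives only at interior times, where the derivative is
    two-sided; joint continuity covers the endpoints 0 and T. *)
Lemma time_increment_le T p pt t t' y B : is_time_derivative T p pt ->
  jointly_continuous T p -> 0 <= t <= T -> 0 <= t' <= T ->
  (forall u, 0 <= u <= T -> `|pt u y| <= B) ->
  `|p t' y - p t y| <= B * `|t' - t|.
Proof.
move=> ppt pc /andP[t0 tT] /andP[t'0 t'T] ptB.
have m0 : 0 <= Num.min t t' by rewrite le_min t0.
have mT : Num.max t t' <= T by rewrite ge_max tT.
have der u : Num.min t t' < u < Num.max t t' -> is_derive u 1 (p ^~ y) (pt u y).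
  move=> /andP[mu uM]; apply: time_derivative_is_derive ppt _.
  by rewrite (le_lt_trans m0)// (lt_le_trans uM).
apply: (MVT_normr_le der).
- exact: jointly_continuous_time pc.
- by move=> u /andP[mu uM]; apply: ptB; rewrite (le_trans m0)// (le_trans uM).
Qed.

Let near_le (y y' z : R) : `|z - y| <= `|y' - y| -> `|z| <= `|y| + `|y' - y|.
Proof.
move=> zy; rewrite -[X in `|X| <= _](subrK y) addrC.
by rewrite (le_trans (ler_normD _ _))// lerD2l.
Qed.

Lemma K2bar_increment T s p t t' y y' : 0 <= s -> K2bar T s p ->
  0 <= t <= T -> 0 <= t' <= T ->
  `|p t' y' - p t y| <= growth s y (y' - y) * (`|t' - t| + `|y' - y|).
Proof.
move=> s0 [pt [py [ppt ppy [pc _ _] pB]]] tT t'T.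
rewrite -(subrK (p t y') (p t' y')) -addrA (le_trans (ler_normD _ _))// mulrDr.
apply: lerD.
- apply: time_increment_le ppt pc _ _ _ => // u uT.
  have := pB u y' uT; rewrite ge_max => /andP[h _].
  by rewrite (le_trans h)// abs_pow_le_growth// near_le.
- apply: space_increment_le ppy _ _ => // z zy.
  have := pB t z tT; rewrite ge_max => /andP[_ h].
  by rewrite (le_trans h)// abs_pow_le_growth// near_le.
Qed.

(** Time is moved at the new position y', to first order. Space is moved at the old time, so the
    first-order coefficient [py t y] depends only on the starting point and is known at the
    beginning of the step. *)
Lemma K2_increment T s p : 0 <= s -> K2 T s p -> exists py : R -> R -> R,
  [/\ forall t, 0 <= t <= T -> measurable_fun setT (py t),
      forall t y, 0 <= t <= T -> `|py t y| <= 1 + `|y| `^ s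
    & forall t t' y y', 0 <= t <= T -> 0 <= t' <= T ->
      `|p t' y' - p t y - py t y * (y' - y)| <=
      growth s y (y' - y) * (`|t' - t| + (y' - y) ^+ 2)].
Proof.
move=> s0 [pt [py [pyy [ppt ppy ppyy [pc _ _ _] pB]]]]; exists py; split.
- move=> t tT; apply: continuous_measurable_fun => y.
  apply: differentiable_continuous; apply/derivable1_diffP.
  by have [] := ppyy t y tT.
- move=> t y tT; have := pB t y tT; rewrite !ge_max => /andP[/andP[_ h] _].
  by rewrite (le_trans h)// lerD2l abs_pow_le_powR.
move=> t t' y y' tT t'T.
have -> : p t' y' - p t y - py t y * (y' - y) = (p t' y' - p t y') +
    ((p t y' - py t y * y') - (p t y - py t y * y)) by ring.
rewrite (le_trans (ler_normD _ _))// mulrDr; apply: lerD.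
- apply: time_increment_le ppt pc _ _ _ => // u uT.
  have := pB u y' uT; rewrite !ge_max => /andP[/andP[h _] _].
  by rewrite (le_trans h)// abs_pow_le_growth// near_le.
rewrite -(real_normK (num_real (y' - y))) expr2 mulrA.
(* After subtracting the linear part, the derivative is [py t z - py t y]; a second mean value
   estimate, with [pyy], bounds it by a multiple of |y' - y|. *)
apply: (@space_increment_le T (fun t z => p t z - py t y * z)
  (fun t z => py t z - py t y) t) => //.
  move=> u z uT; have h1 : is_derive z 1 (p u) (py u z) by exact: ppy.
  have h2 : is_derive z 1 (fun z => py u y * z) (py u y).
    have := is_deriveZ (py u y) (is_derive_id z (1 : R)).
    by rewrite /GRing.scale/= mulr1.
  exact: is_deriveB.
move=> z zy; apply: (le_trans (space_increment_le (B := growth s y (y' - y)) ppyy tT _)).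
  move=> v vz; have := pB t v tT; rewrite !ge_max => /andP[_ h].
  rewrite (le_trans h)// abs_pow_le_growth// near_le//.
  exact: le_trans vz zy.
by rewrite ler_wpM2l// growth_ge0.
Qed.
End disturbing_increments.

(** * Error of the noisy quadrature *)

Section Lr_bounds.
Context d (Omega : measurableType d) (R : realType) (P : probability Omega R).
Variable r : R.
Hypothesis r1 : 1 <= r.
Implicit Types (f g : Omega -> R) (a b k : R).

(** The bound is put on the r-th moment, the form given by independence and by the sums of
    increments; [Lnorm_leP] converts it to the norm for Minkowski. *)
Definition Lr_bounded f b := [/\ measurable_fun setT f, 0 <= b &
  (\int[P]_w (`|f w| `^ r)%:E <= (b `^ r)%:E)%E].

Let r0 : 0 < r. Proof. exact: lt_le_trans r1. Qed.

Lemma Lnorm_powR f :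
  ('N[P]_r%:E[EFin \o f] `^ r = \int[P]_w (`|f w| `^ r)%:E)%E.
Proof.
by rewrite poweR_Lnorm ?gt_eqF.
Qed.

Let poweR_le (x y : \bar R) p : 0 <= p -> (0 <= x)%E -> (x <= y)%E ->
  (x `^ p <= y `^ p)%E.
Proof.
move=> p0 x0 xy; apply: gt0_ler_poweR => //.
  by rewrite in_itv/= x0 leey.
by rewrite in_itv/= (le_trans x0 xy) leey.
Qed.

Lemma Lnorm_leP f b : 0 <= b ->
  ('N[P]_r%:E[EFin \o f] <= b%:E)%E <->
  (\int[P]_w (`|f w| `^ r)%:E <= (b `^ r)%:E)%E.
Proof.
move=> b0; rewrite -Lnorm_powR -poweR_EFin; split => h.
  by apply: poweR_le h; [exact: ltW|exact: Lnorm_ge0].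
have ri0 : 0 <= r^-1 by rewrite invr_ge0 ltW.
have := poweR_le ri0 (poweR_ge0 _ _) h.
by rewrite -!poweRrM divff ?gt_eqF// !poweRe1// ?lee_fin// Lnorm_ge0.
Qed.

Lemma Lr_bounded_cst k : 0 <= k -> Lr_bounded (fun=> k) k.
Proof.
move=> k0; split => //; rewrite integral_cst// ger0_norm//.
by rewrite [X in (_ * X)%E]probability_setT mule1.
Qed.

Lemma Lr_bounded_le f g b : measurable_fun setT f -> (forall w, `|f w| <= `|g w|) ->
  Lr_bounded g b -> Lr_bounded f b.
Proof.
move=> mf fg [mg b0 gb]; split => //; apply: le_trans gb.
apply: le_integral_EFin => w; first exact: powR_ge0.
by rewrite powR_le_mono ?(ltW r0).
Qed.

Lemma Lr_boundedD f g a b : Lr_bounded f a -> Lr_bounded g b ->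
  Lr_bounded (f \+ g) (a + b).
Proof.
move=> [mf a0 fa] [mg b0 gb].
split; [exact: measurable_funD|exact: addr_ge0|].
apply/Lnorm_leP; first exact: addr_ge0.
rewrite EFinD (le_trans (minkowski_EFin _ mf mg r1))// leeD//; exact/Lnorm_leP.
Qed.

Lemma Lr_bounded_normr f b : Lr_bounded f b -> Lr_bounded (fun w => `|f w|) b.
Proof.
move=> [mf b0 fb]; apply: (Lr_bounded_le (g := f)) => //.
  exact: measurableT_comp.
by move=> w; rewrite normr_id.
Qed.

Lemma Lr_boundedZ f b k : 0 <= k -> Lr_bounded f b ->
  Lr_bounded (fun w => k * f w) (k * b).
Proof.
move=> k0 [mf b0 fb]; split; [exact: measurable_funM|exact: mulr_ge0|].
under eq_integral do rewrite normrM (ger0_norm k0) powRM//.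
rewrite (ge0_integralZ_EFin P (powR_ge0 k r)).
- by rewrite powRM// [leRHS]EFinM lee_wpmul2l// lee_fin powR_ge0.
- by apply: (measurableT_comp (measurable_powR _)); exact: measurableT_comp.
- by move=> w; exact: powR_ge0.
Qed.

Lemma Lr_bounded_sum n (f : nat -> Omega -> R) (b : nat -> R) :
  (forall i, (i < n)%N -> Lr_bounded (f i) (b i)) ->
  Lr_bounded (fun w => \sum_(i < n) f i w) (\sum_(i < n) b i).
Proof.
elim: n => [|n IH] fb.
  under eq_fun do rewrite big_ord0.
  by rewrite big_ord0; exact: Lr_bounded_cst.
under eq_fun do rewrite big_ord_recr/=.
rewrite big_ord_recr; apply: Lr_boundedD; last exact: fb.
by apply: IH => i ni; apply: fb; exact: ltnW.
Qed.

Lemma Lnorm_le_Lr_bounded f g b : (forall w, `|f w| <= g w) -> Lr_bounded g b ->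
  ('N[P]_r%:E[(fun w => (f w)%:E)] <= b%:E)%E.
Proof.
move=> fg [mg b0 gb]; apply/(@Lnorm_leP f) => //; apply: le_trans gb.
apply: le_integral_EFin => w; first exact: powR_ge0.
by rewrite powR_le_mono ?(ltW r0)// (le_trans (fg w))// ler_norm.
Qed.

(** Here [g] stands for a supremum over uncountably many times; monotonicity of the integral of
    nonnegative functions holds without measurability. *)
Lemma integral_le_of_Lnorm_sup (f : Omega -> R) (g : Omega -> \bar R) b :
  0 <= b -> (forall w, (`|f w|%:E <= g w)%E) ->
  ('N[P]_r%:E[g] <= b%:E)%E ->
  (\int[P]_w (`|f w| `^ r)%:E <= (b `^ r)%:E)%E.
Proof.
move=> b0 fg gb; have := poweR_le (ltW r0) (Lnorm_ge0 _ _ _) gb.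
rewrite poweR_Lnorm ?gt_eqF// poweR_EFin; apply: le_trans.
apply: ge0_le_integralT => w; first by rewrite lee_fin powR_ge0.
rewrite -poweR_EFin; apply: poweR_le; rewrite ?(ltW r0) ?lee_fin//.
by apply: (le_trans (fg w)); exact: lee_abs.
Qed.
End Lr_bounds.

Section moments.
Context {R : realType}.

Let measurable_powR_normr d (Omega : measurableType d) (f : Omega -> R) p :
  measurable_fun setT f -> measurable_fun setT (fun w => `|f w| `^ p).
Proof.
by move=> mf; apply: (measurableT_comp (measurable_powR _)); exact: measurableT_comp.
Qed.

Lemma wiener_moment (p T : R) : 0 <= p -> 0 < T ->
  exists2 K, 0 < K & forall d (Omega : measurableType d)
    (P : probability Omega R) (F : R -> set (set Omega)) (W : R -> Omega -> R),
  filtration F -> wiener_process P F W -> forall t, 0 <= t <= T ->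
  (\int[P]_w (`|W t w| `^ p)%:E <= K%:E)%E.
Proof.
move=> p0 T0; have [K K0 HK] := wiener_incr_moment p0.
exists (K * T `^ (p / 2) + 1) => [|d Omega P F W filF wW t /andP[t0 tT]].
  by rewrite ltr_wpDl// mulr_ge0 ?powR_ge0// ltW.
have [W0 _ _ _ _] := wW.
have [t0'|t0'] := eqVneq t 0.
  rewrite t0'; apply: (@le_trans _ _ 1%E); last first.
    by rewrite lee_fin lerDr mulr_ge0 ?powR_ge0// ltW.
  (* At time 0 the moment is that of the constant 0, which is 1 if p = 0; this accounts for the
     summand 1 in the constant. *)
  have -> : (\int[P]_w (`|W 0 w| `^ p)%:E = \int[P]_w (cst (`|0 : R| `^ p)%:E) w)%E.
    apply: ae_eq_integral => //.
    + apply/measurable_EFinP; apply: measurable_powR_normr.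
      exact: (wiener_measurable filF wW).
    + by apply: filterS W0 => w /= -> _.
  - rewrite integral_cst// [X in (_ * X)%E]probability_setT mule1 lee_fin.
    by rewrite normr0; have [->|p00] := eqVneq p 0; rewrite ?powRr0// powR0.
have {}t0' : 0 < t by rewrite lt_neqAle eq_sym t0'.
have -> : (\int[P]_w (`|W t w| `^ p)%:E =
    \int[P]_w (`|W t w - W 0 w| `^ p)%:E)%E.
  apply: ae_eq_integral => //.
  - apply/measurable_EFinP; apply: measurable_powR_normr.
    exact: (wiener_measurable filF wW).
  - apply/measurable_EFinP; apply: measurable_powR_normr.
    by apply: measurable_funB; exact: (wiener_measurable filF wW).
  - by apply: filterS W0 => w /= -> _; rewrite subr0.
apply: (le_trans (HK _ _ _ _ _ filF wW _ _ (lexx 0) t0')).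
rewrite lee_fin subr0 ler_wpDr// ler_wpM2l ?(ltW K0)//.
by rewrite powR_le_mono// divr_ge0.
Qed.

Let powR1D_le (x p : R) : 0 <= x -> 0 <= p -> (1 + x) `^ p <= 2 `^ p * (1 + x `^ p).
Proof. by move=> x0 p0; have := powRD_le ler01 x0 p0; rewrite powR1. Qed.

(** Expanding leaves moments of orders s r, m r and (s + m) r. The factor 1 + |h|^s costs a
    constant, since D^(s r / 2) is bounded by its value [b] at T, while |h|^m contributes the size
    D^(m/2). *)
Lemma wiener_incr_growth_moment (r T s a m : R) : 1 <= r -> 0 < T ->
  0 <= s -> 0 <= a -> 0 < m ->
  exists2 c, 0 < c & forall d (Omega : measurableType d)
    (P : probability Omega R) (F : R -> set (set Omega)) (W : R -> Omega -> R),
  filtration F -> wiener_process P F W ->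
  forall u v, 0 <= u -> u < v -> v <= T ->
  (\int[P]_w (((1 + `|W v w - W u w| `^ s) *
               ((v - u) `^ a + `|W v w - W u w| `^ m)) `^ r)%:E <=
   ((c * ((v - u) `^ a + (v - u) `^ (m / 2))) `^ r)%:E)%E.
Proof.
move=> r1 T0 s0 a0 m0; have r0 : 0 < r by exact: lt_le_trans r1.
have [Ks Ks0 HKs] := @wiener_incr_moment R (s * r) (mulr_ge0 s0 (ltW r0)).
have [Km Km0 HKm] := @wiener_incr_moment R (m * r) (mulr_ge0 (ltW m0) (ltW r0)).
have [Kt Kt0 HKt] := @wiener_incr_moment R ((s + m) * r)
  (mulr_ge0 (addr_ge0 s0 (ltW m0)) (ltW r0)).
pose b : R := T `^ (s * r / 2).
have b0 : 0 <= b by exact: powR_ge0.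
pose C : R := 2 `^ r * 2 `^ r * (1 + Ks * b + Km + Kt * b).
have C0 : 0 < C.
  rewrite !mulr_gt0 ?powR_gt0// ltr_wpDr ?mulr_ge0 ?(ltW Kt0)//.
  by rewrite addr_gt0// ltr_wpDr ?mulr_ge0 ?(ltW Ks0).
exists ((2 * C) `^ r^-1) => [|d Omega P F W filF wW u v u0 uv vT].
  by apply: powR_gt0; rewrite mulr_gt0.
set D := v - u; pose xi w := `|W v w - W u w|.
have D0 : 0 < D by rewrite subr_gt0.
have DT : D <= T by rewrite /D; lra.
have xi0 w : 0 <= xi w by exact: normr_ge0.
have mxi p : measurable_fun setT (fun w => xi w `^ p).
  apply: measurable_powR_normr; apply: measurable_funB;
    apply: (wiener_measurable filF wW) => //.
  exact: le_trans (ltW uv).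
have {}HKs := HKs _ _ P F W filF wW u v u0 uv.
have {}HKm := HKm _ _ P F W filF wW u v u0 uv.
have {}HKt := HKt _ _ P F W filF wW u v u0 uv.
have A0 : 0 <= D `^ (a * r) by exact: powR_ge0.
pose f1 w := D `^ (a * r) * xi w `^ (s * r).
have ptw w : ((1 + xi w `^ s) * (D `^ a + xi w `^ m)) `^ r <= 2 `^ r * 2 `^ r *
   ((D `^ (a * r) + f1 w) + (xi w `^ (m * r) + xi w `^ ((s + m) * r))).
  rewrite powRM ?addr_ge0 ?powR_ge0//.
  have h1 := powR1D_le (powR_ge0 (xi w) s) (ltW r0).
  have h2 := powRD_le (powR_ge0 D a) (powR_ge0 (xi w) m) (ltW r0).
  apply: (le_trans (ler_pM _ _ h1 h2)); rewrite ?powR_ge0// -!powRrM.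
  have -> : xi w `^ ((s + m) * r) = xi w `^ (s * r) * xi w `^ (m * r).
    rewrite mulrDl powRD//; apply/implyP => /eqP e0.
    have : 0 < s * r + m * r by rewrite -mulrDl mulr_gt0// ltr_wpDl.
    by rewrite e0 ltxx.
  by rewrite /f1 le_eqVlt; apply/orP; left; apply/eqP; ring.
apply: (le_trans (le_integral_EFin P _ ptw)) => [w|]; first exact: powR_ge0.
have f10 w : 0 <= f1 w by rewrite mulr_ge0 ?powR_ge0.
have mf1 : measurable_fun setT f1 by exact: measurable_funM.
rewrite (ge0_integralZ_EFin P (mulr_ge0 (powR_ge0 2 r) (powR_ge0 2 r))); first last.
- by move=> w; rewrite !addr_ge0 ?powR_ge0.
- by apply: measurable_funD; apply: measurable_funD.
rewrite (ge0_integralD_EFin P (f := fun w => D `^ (a * r) + f1 w)); first last.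
- by move=> w; rewrite addr_ge0 ?powR_ge0.
- by move=> w; rewrite addr_ge0 ?powR_ge0.
- exact: measurable_funD.
- exact: measurable_funD.
rewrite (ge0_integralD_EFin P (f := fun=> D `^ (a * r)))//.
rewrite (ge0_integralD_EFin P (f := fun w => xi w `^ (m * r)))//; last 2 first.
- by move=> w; exact: powR_ge0.
- by move=> w; exact: powR_ge0.
rewrite (ge0_integralZ_EFin P A0)//; last by move=> w; exact: powR_ge0.
rewrite integral_cst// [X in (_ * X + _ + _)%E]probability_setT mule1.
apply: (@le_trans _ _ ((2 `^ r * 2 `^ r)%:E * (((D `^ (a * r))%:E +
   (D `^ (a * r))%:E * (Ks * D `^ (s * r / 2))%:E) +
   ((Km * D `^ (m * r / 2))%:E + (Kt * D `^ ((s + m) * r / 2))%:E)))%E).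
  rewrite lee_wpmul2l ?lee_fin ?mulr_ge0 ?powR_ge0//.
  by rewrite leeD// leeD// lee_wpmul2l.
rewrite -(EFinM (D `^ _)) -!EFinD -EFinM lee_fin.
have -> : ((2 * C) `^ r^-1 * (D `^ a + D `^ (m / 2))) `^ r =
    2 * C * (D `^ a + D `^ (m / 2)) `^ r.
  rewrite powRM ?addr_ge0 ?powR_ge0// -powRrM mulVf ?gt_eqF// powRr1//.
  by rewrite mulr_ge0// ltW.
have h1 : D `^ (a * r) <= (D `^ a + D `^ (m / 2)) `^ r.
  by rewrite (powRrM D a) powR_le_mono ?powR_ge0 ?(ltW r0)// lerDl powR_ge0.
have h2 : D `^ (m * r / 2) <= (D `^ a + D `^ (m / 2)) `^ r.
  rewrite (mulrAC m) (powRrM D (m / 2)) powR_le_mono ?powR_ge0 ?(ltW r0)//.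
  by rewrite lerDr powR_ge0.
have h3 : D `^ (s * r / 2) <= b.
  by rewrite powR_le_mono ?(ltW D0)// !mulr_ge0// ?invr_ge0// ltW.
have h4 : D `^ ((s + m) * r / 2) <= b * D `^ (m * r / 2).
  have -> : (s + m) * r / 2 = s * r / 2 + m * r / 2 by ring.
  by rewrite powRD ?(gt_eqF D0) ?implybT// ler_wpM2r ?powR_ge0.
set E := (_ + _) `^ r in h1 h2 *; have E0 : 0 <= E := powR_ge0 _ _.
set y := D `^ (m * r / 2) in h2 h4 *; have y0 : 0 <= y := powR_ge0 _ _.
have x0 : 0 <= D `^ (a * r) by exact: powR_ge0.
have k1 : D `^ (a * r) * (Ks * D `^ (s * r / 2)) <= E * (Ks * b).
  by rewrite ler_pM// ?mulr_ge0 ?powR_ge0 ?(ltW Ks0)// ler_wpM2l// ltW.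
have k2 : Km * y <= Km * E by rewrite ler_wpM2l// ltW.
have k3 : Kt * D `^ ((s + m) * r / 2) <= Kt * (b * E).
  by rewrite ler_wpM2l ?(ltW Kt0)// (le_trans h4)// ler_wpM2l.
set c := 2 `^ r * 2 `^ r; have c0 : 0 <= c by rewrite mulr_ge0 ?powR_ge0.
have := ler_wpM2l c0 (lerD (lerD h1 k1) (lerD k2 k3)).
have : 0 <= C * E by rewrite mulr_ge0// ltW.
rewrite /C -/c; lra.
Qed.

Lemma Lr_bounded_weight (r q L T s : R) : 1 <= r -> r < q -> 0 <= L -> 0 < T ->
  0 <= s -> exists2 b, 0 < b & forall d (Omega : measurableType d)
    (P : probability Omega R) (F : R -> set (set Omega)) (W : R -> Omega -> R),
  filtration F -> wiener_process P F W -> forall t, 0 <= t <= T ->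
  forall Z : Omega -> R, measurable_fun setT Z ->
  (\int[P]_w (`|Z w| `^ q)%:E <= (L `^ q)%:E)%E ->
  Lr_bounded P r (fun w => (1 + `|Z w|) * (1 + `|W t w| `^ s)) b.
Proof.
move=> r1 rq L0 T0 s0; have r0 : 0 < r by exact: lt_le_trans r1.
have q0 : 0 < q by exact: lt_trans rq.
have qr0 : 0 < q - r by rewrite subr_gt0.
(* Young's inequality for the conjugate exponents [q / r] and [m / r]. *)
pose m := q * r / (q - r); have m0 : 0 < m by rewrite divr_gt0// mulr_gt0.
have [K K0 HK] := @wiener_moment (s * m) T (mulr_ge0 s0 (ltW m0)) T0.
pose C : R := 2 `^ q * (1 + L `^ q) + 2 `^ m * (1 + K).
have C0 : 0 < C.
  by rewrite addr_gt0// mulr_gt0 ?powR_gt0// ltr_wpDr ?powR_ge0// ltW.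
exists (C `^ r^-1) => [|d Omega P F W filF wW t tT Z mZ Zq]; first exact: powR_gt0.
have t0 : 0 <= t by case/andP: tT.
have mW := wiener_measurable filF wW t0.
have ZW0 w : 0 <= (1 + `|Z w|) * (1 + `|W t w| `^ s).
  by rewrite mulr_ge0 ?addr_ge0 ?powR_ge0.
split; [|exact: powR_ge0|].
  apply: measurable_funM; apply: measurable_funD => //.
    exact: measurableT_comp.
  exact: measurable_powR_normr.
rewrite -powRrM mulVf ?gt_eqF// powRr1 ?(ltW C0)//.
have ptw w : `|(1 + `|Z w|) * (1 + `|W t w| `^ s)| `^ r <=
    2 `^ q * (1 + `|Z w| `^ q) + 2 `^ m * (1 + `|W t w| `^ (s * m)).
  rewrite ger0_norm// powRM ?addr_ge0 ?powR_ge0//.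
  set a := 1 + `|Z w|; set b := 1 + `|W t w| `^ s.
  have := @powRM_le_powRD R (a `^ q) (b `^ m) (r / q) ((q - r) / q)
    (powR_ge0 _ _) (powR_ge0 _ _).
  rewrite -!powRrM.
  have -> : q * (r / q) = r by field; exact: lt0r_neq0.
  have -> : m * ((q - r) / q) = r by rewrite /m; field; rewrite !gt_eqF.
  have -> : r / q + (q - r) / q = 1 by field; exact: lt0r_neq0.
  rewrite !mulr1 => h; apply: le_trans (h _ _ _) _ => //.
  - by rewrite divr_ge0// ltW.
  - by rewrite divr_ge0// ltW.
  by rewrite lerD// ?(powRrM _ s m) powR1D_le ?powR_ge0// ltW.
apply: (le_trans (le_integral_EFin P _ ptw)) => [w|]; first exact: powR_ge0.
have mZq : measurable_fun setT (fun w => `|Z w| `^ q) by exact: measurable_powR_normr.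
have mWm : measurable_fun setT (fun w => `|W t w| `^ (s * m)).
  exact: measurable_powR_normr.
rewrite (ge0_integralD_EFin P (f := fun w => 2 `^ q * (1 + `|Z w| `^ q))); first last.
- by move=> w; rewrite mulr_ge0 ?addr_ge0 ?powR_ge0.
- by move=> w; rewrite mulr_ge0 ?addr_ge0 ?powR_ge0.
- by apply: measurable_funM => //; exact: measurable_funD.
- by apply: measurable_funM => //; exact: measurable_funD.
rewrite (ge0_integralZ_EFin P (powR_ge0 2 q)); first last.
- by move=> w; rewrite addr_ge0 ?powR_ge0.
- exact: measurable_funD.
rewrite (ge0_integralZ_EFin P (powR_ge0 2 m)); first last.
- by move=> w; rewrite addr_ge0 ?powR_ge0.
- exact: measurable_funD.
have int1 (f : Omega -> R) k : measurable_fun setT f -> (forall w, 0 <= f w) ->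
    (\int[P]_w (f w)%:E <= k%:E)%E -> (\int[P]_w (1 + f w)%:E <= (1 + k)%:E)%E.
  move=> mf f0 fk; rewrite (ge0_integralD_EFin P (f := fun=> 1))//.
  rewrite integral_cst// [X in (_ * X + _)%E]probability_setT mule1 EFinD.
  by rewrite leeD2l.
rewrite /C [leRHS]EFinD leeD// EFinM.
  by rewrite lee_wpmul2l ?lee_fin ?powR_ge0//; apply: int1 => // w; exact: powR_ge0.
rewrite lee_wpmul2l ?lee_fin ?powR_ge0//; apply: int1 => //; exact: HK filF wW _ tT.
Qed.

(** For exponent 0 the second factor is the constant 2, since 0^0 = 1 for [powR], so moments of [Z]
    alone suffice and q = r is admissible. *)
Lemma Lr_bounded_weight0 (r q L : R) : 1 <= r -> r <= q -> 0 <= L ->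
  exists2 b, 0 < b & forall d (Omega : measurableType d)
    (P : probability Omega R), forall Z V : Omega -> R, measurable_fun setT Z ->
  (\int[P]_w (`|Z w| `^ q)%:E <= (L `^ q)%:E)%E ->
  Lr_bounded P r (fun w => (1 + `|Z w|) * (1 + `|V w| `^ 0)) b.
Proof.
move=> r1 rq L0; have r0 : 0 < r by exact: lt_le_trans r1.
have q0 : 0 < q by exact: lt_le_trans rq.
pose C : R := 2 `^ q * (1 + L `^ q).
have C0 : 0 < C by rewrite mulr_gt0 ?powR_gt0// ltr_wpDr ?powR_ge0.
exists (2 * C `^ r^-1) => [|d Omega P Z V mZ Zq]; first by rewrite mulr_gt0 ?powR_gt0.
under eq_fun do rewrite powRr0 mulrC.
apply: Lr_boundedZ => //; split; [|exact: powR_ge0|].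
  by apply: measurable_funD => //; exact: measurableT_comp.
rewrite -powRrM mulVf ?gt_eqF// powRr1 ?(ltW C0)//.
apply: (@le_trans _ _ (\int[P]_w (2 `^ q * (1 + `|Z w| `^ q))%:E)%E).
  apply: le_integral_EFin => w; first exact: powR_ge0.
  rewrite ger0_norm ?addr_ge0//.
  rewrite (le_trans _ (powR1D_le _ (ltW q0)))//.
  by rewrite ler_powR// lerDl.
rewrite (ge0_integralZ_EFin P (powR_ge0 2 q)); first last.
- by move=> w; rewrite addr_ge0 ?powR_ge0.
- by apply: measurable_funD => //; exact: measurable_powR_normr.
rewrite (ge0_integralD_EFin P (f := fun=> 1))//; last exact: measurable_powR_normr.
rewrite integral_cst// [X in (_ * (_ * X + _))%E]probability_setT mule1.
by rewrite /C EFinM EFinD lee_wpmul2l ?lee_fin ?powR_ge0// leeD2l.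
Qed.
End moments.

Section error_decomposition.
Context d (Omega : measurableType d) (R : realType) (P : probability Omega R).
Variables (F : R -> set (set Omega)) (W : R -> Omega -> R) (T r L rho q s : R).
Variable X : R -> Omega -> R.
Hypotheses (filF : filtration F) (wW : wiener_process P F W) (T0 : 0 < T).
Hypotheses (r2 : 2 <= r) (rq : r <= q) (rho0 : 0 < rho) (L0 : 0 <= L).
Hypothesis XF : integrand_class P F T rho r q L X.

Let r1 : 1 <= r. Proof. by apply: le_trans r2; rewrite ler1n. Qed.
Let r0 : 0 < r. Proof. exact: lt_le_trans r1. Qed.
Let q1 : 1 <= q. Proof. exact: le_trans rq. Qed.

Lemma integrand_class_moment t : 0 <= t <= T ->
  (\int[P]_w (`|X t w| `^ q)%:E <= (L `^ q)%:E)%E.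
Proof.
move=> tT; case: XF => _ Xsup _.
apply: (integral_le_of_Lnorm_sup q1 L0 _ Xsup) => w.
by apply: ereal_sup_ubound; exists t => //=; rewrite in_itv.
Qed.

Lemma integrand_class_holder t z : 0 <= t <= T -> 0 <= z <= T ->
  (\int[P]_w (`|X t w - X z w| `^ r)%:E <= ((L * `|t - z| `^ rho) `^ r)%:E)%E.
Proof.
move=> tT zT; case: XF => _ _ Xh.
apply/(@Lnorm_leP _ _ _ P _ r1 (fun w => X t w - X z w)); last exact: Xh.
by rewrite mulr_ge0 ?powR_ge0.
Qed.

Let X_prog : progressively_measurable F T X. Proof. by case: XF. Qed.

Variables (n : nat) (t : nat -> R) (tP : discretization T n t).
Local Notation dt i := (t i.+1 - t i).
Local Notation dW i w := (W (t i.+1) w - W (t i) w).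

Let tT i : (i < n)%N -> 0 <= t i <= T.
Proof. by move=> ni; exact: (discretization_itv tP) (ltnW ni). Qed.

Let t0 i : (i < n)%N -> 0 <= t i. Proof. by move=> /tT/andP[]. Qed.

Let tST i : (i < n)%N -> 0 <= t i.+1 <= T.
Proof. by move=> ni; exact: (discretization_itv tP). Qed.

Let t_lt i : (i < n)%N -> t i < t i.+1. Proof. by case: tP => _ _; exact. Qed.

(** With a uniform bound on the weights, the cell lengths add up to T and no dependence on the grid
    remains. *)
Lemma martingale_Lr_bounded K (Y : nat -> Omega -> R) b : 0 <= K ->
  wiener_sum_bound P F W T r K -> 0 <= b ->
  (forall i, (i < n)%N -> sub_measurable (F (t i)) (Y i)) ->
  (forall i, (i < n)%N -> Lr_bounded P r (Y i) b) ->
  Lr_bounded P r (fun w => \sum_(i < n) Y i w * dW i w) ((K * T) `^ r^-1 * b).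
Proof.
move=> K0 HK b0 FY Yb; have KT0 : 0 <= K * T by rewrite mulr_ge0// ltW.
split.
- apply: (weighted_sum_measurable filF wW tP) => i ni.
  exact: (adapted_measurable filF (t0 ni)) (FY _ ni).
- by rewrite mulr_ge0 ?powR_ge0.
apply: (le_trans (HK n t tP Y (fun=> b `^ r) FY _)) => [i ni|].
  by case: (Yb i ni).
rewrite lee_fin -mulr_sumr (discretization_sum tP) powRM ?powR_ge0//.
rewrite -powRrM mulVf ?gt_eqF// powRr1// le_eqVlt; apply/orP; left.
by apply/eqP; ring.
Qed.

Variables (psi : R) (psi0 : 0 <= psi).
(** Majorant of what is known at time u: 1 + |X| controls the noisy integrand up to the factor 1 +
    delta1, and 1 + |W|^s the growth of the disturbance of [W]. *)
Let Psi u w := (1 + `|X u w|) * (1 + `|W u w| `^ s).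
Hypothesis HPsi : forall u, 0 <= u <= T -> Lr_bounded P r (Psi u) psi.

Let Psi_ge0 u w : 0 <= Psi u w.
Proof. by rewrite mulr_ge0 ?addr_ge0 ?powR_ge0. Qed.

Let F_measurable i (U : Omega -> R) : (i < n)%N ->
  sub_measurable (F (t i)) U <->
  measurable_fun [set: g_sigma_algebraType (F (t i))] (U : _ -> R).
Proof. by move=> ni; exact: sub_measurableP (filtration_sigma filF (t0 ni)) U. Qed.

Let X_adapted i : (i < n)%N ->
  measurable_fun [set: g_sigma_algebraType (F (t i))] (X (t i) : _ -> R).
Proof. by move=> ni; apply/(F_measurable _ ni)/(progressive_adapted filF X_prog)/tT. Qed.

Let W_adapted i : (i < n)%N ->
  measurable_fun [set: g_sigma_algebraType (F (t i))] (W (t i) : _ -> R).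
Proof. by move=> ni; apply/(F_measurable _ ni)/(wiener_sub_measurable wW)/t0. Qed.

Let Psi_adapted i : (i < n)%N -> sub_measurable (F (t i)) (Psi (t i)).
Proof.
move=> ni; apply/(F_measurable _ ni); apply: measurable_funM.
  by apply: measurable_funD => //; apply: measurableT_comp => //; exact: X_adapted.
apply: measurable_funD => //; apply: (measurableT_comp (measurable_powR _)).
by apply: measurableT_comp => //; exact: W_adapted.
Qed.

Variables (a m c : R) (c0 : 0 <= c).
Hypothesis Hc : forall u v, 0 <= u -> u < v -> v <= T ->
  (\int[P]_w (((1 + `|W v w - W u w| `^ s) *
               ((v - u) `^ a + `|W v w - W u w| `^ m)) `^ r)%:E <=
   ((c * ((v - u) `^ a + (v - u) `^ (m / 2))) `^ r)%:E)%E.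

Let g i (x : R) := (1 + `|x| `^ s) * (dt i `^ a + `|x| `^ m).

Let g_ge0 i x : 0 <= g i x.
Proof. by rewrite mulr_ge0 ?addr_ge0 ?powR_ge0. Qed.

Let measurable_g i : measurable_fun setT (g i).
Proof.
have mp p : measurable_fun setT (fun x : R => `|x| `^ p).
  exact: (measurableT_comp (measurable_powR _)).
by apply: measurable_funM; apply: measurable_funD.
Qed.

Let remainder w := \sum_(i < n) Psi (t i) w * g i (dW i w).

(** In each summand the two factors are independent, so their r-th moments multiply. The summands
    are not centered and are added by Minkowski, which leaves a sum over the grid instead of a
    maximum. *)
Lemma remainder_Lr_bounded : Lr_bounded P r remainder
  (\sum_(i < n) psi * (c * (dt i `^ a + dt i `^ (m / 2)))).
Proof.
apply: (Lr_bounded_sum r1 (f := fun i w => Psi (t i) w * g i (dW i w))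
  (b := fun i => psi * (c * (dt i `^ a + dt i `^ (m / 2))))) => i ni.
have [mPsi _ Psi_r] := HPsi (tT ni).
have mdW := wiener_incr_measurable filF wW (t0 ni) (t_lt ni).
split.
- apply: measurable_funM => //; exact: (measurableT_comp (measurable_g i) mdW).
- by rewrite mulr_ge0// mulr_ge0// addr_ge0 ?powR_ge0.
have mpr : measurable_fun setT (fun x : R => `|x| `^ r).
  exact: (measurableT_comp (measurable_powR _)).
have -> : (\int[P]_w (`|Psi (t i) w * g i (dW i w)| `^ r)%:E =
  \int[P]_w (`|Psi (t i) w| `^ r * (g i ((W (t i.+1) \- W (t i)) w) `^ r))%:E)%E.
  by apply: eq_integral => w _; rewrite normrM powRM// (ger0_norm (g_ge0 _ _)).
rewrite (ge0_integral_wiener_indep filF wW (t0 ni) (t_lt ni)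
  (U := fun w => `|Psi (t i) w| `^ r) (g := fun x => g i x `^ r)).
- rewrite powRM ?mulr_ge0 ?addr_ge0 ?powR_ge0// EFinM; apply: lee_pmul => //.
  + by apply: integral_ge0 => w _; rewrite lee_fin powR_ge0.
  + by apply: integral_ge0 => w _; rewrite lee_fin powR_ge0.
  + by have /andP[_ tS] := tST ni; exact: Hc (t0 ni) (t_lt ni) tS.
- apply/(F_measurable _ ni); apply: (measurableT_comp mpr).
  exact/(F_measurable _ ni)/Psi_adapted.
- by move=> w; exact: powR_ge0.
- exact: (measurableT_comp (measurable_powR _) (measurable_g i)).
- by move=> x; exact: powR_ge0.
Qed.

(* [Q = 0], with [b0 = 0], when [pW] is only differentiated once or not at all. *)
Variables (delta1 delta2 : R) (d10 : 0 <= delta1) (d20 : 0 <= delta2).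
Variables (Xt Wt : R -> Omega -> R) (pX pW Q : R -> R -> R) (b0 : R).
Hypothesis pXK : K1 T pX.
Hypothesis XtE : forall u w, 0 <= u <= T -> Xt u w = X u w + delta1 * pX u (X u w).
Hypothesis WtE : forall u w, 0 <= u <= T -> Wt u w = W u w + delta2 * pW u (W u w).
Hypotheses (b00 : 0 <= b0).
Hypothesis mQ : forall u, 0 <= u <= T -> measurable_fun setT (Q u).
Hypothesis Q_le : forall u y, 0 <= u <= T -> `|Q u y| <= b0 * (1 + `|y| `^ s).
Hypothesis pW_le : forall u v y z, 0 <= u -> u < v -> v <= T ->
  `|pW v z - pW u y - Q u y * (z - y)| <= 2 `^ s * ((1 + `|y| `^ s) *
    ((1 + `|z - y| `^ s) * ((v - u) `^ a + `|z - y| `^ m))).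
Variables (K2 Kr : R) (K20 : 0 <= K2) (Kr0 : 0 <= Kr).
Hypotheses (HK2 : wiener_sum_bound P F W T 2 K2) (HKr : wiener_sum_bound P F W T r Kr).
Variables (I : Omega -> R) (HI : ito_integral P F T W X I).

Let mpX u : 0 <= u <= T -> measurable_fun setT (pX u).
Proof.
move=> uT; case: pXK => mp _.
apply: (@measurable_comp _ _ _ _ _ _ (`[0, T] `*` setT)
  (fun z : R * R => pX z.1 z.2) setT (fun x => (u, x))) => //.
- by apply: measurableX => //; exact: measurable_itv.
- by move=> _ [x _ <-]; split => //=; rewrite in_itv.
- exact: measurable_fun_pair.
Qed.

Let pX_le u w : 0 <= u <= T -> `|pX u (X u w)| <= 1 + `|X u w|.
Proof. by case: pXK => _; exact. Qed.

Let Xt_le u w : 0 <= u <= T -> `|Xt u w| <= (1 + delta1) * (1 + `|X u w|).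
Proof.
move=> uT; rewrite XtE// (le_trans (ler_normD _ _))// normrM (ger0_norm d10).
have := ler_wpM2l d10 (pX_le w uT); lra.
Qed.

Let mesh := mesh_pow n t rho.

Let mesh_le i : (i < n)%N -> L * dt i `^ rho <= L * mesh.
Proof.
move=> ni; rewrite ler_wpM2l//.
exact: (@le_bigmax _ _ _ _ (fun i : 'I_n => dt i `^ rho) (Ordinal ni)).
Qed.

Let S1 w := \sum_(i < n) pX (t i) (X (t i) w) * dW i w.
Let S2 w := \sum_(i < n) (Xt (t i) w * Q (t i) (W (t i) w)) * dW i w.
Let A w := \sum_(i < n) X (t i) w * dW i w.
(** [k1] and [k2] are the r-th roots of the factors in the moment bounds for the Ito error and for
    sums with uniformly bounded weights. *)
Let k1 := (2 `^ r * (Kr * T)) `^ r^-1.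
Let k2 := (Kr * T) `^ r^-1.

Let S1_Lr : Lr_bounded P r S1 (k2 * psi).
Proof.
apply: (martingale_Lr_bounded (Y := fun i w => pX (t i) (X (t i) w)) Kr0 HKr psi0)
  => i ni.
  apply/(F_measurable _ ni).
  exact: (measurableT_comp (mpX (tT ni)) (X_adapted ni)).
have mX := adapted_measurable filF (t0 ni) (progressive_adapted filF X_prog (tT ni)).
apply: (Lr_bounded_le r1 (g := Psi (t i))) => [|w|]; last exact: HPsi (tT ni).
  exact: (measurableT_comp (mpX (tT ni)) mX).
 rewrite (ger0_norm (Psi_ge0 _ _)) (le_trans (pX_le w (tT ni)))//.
by rewrite ler_peMr ?addr_ge0// lerDl powR_ge0.
Qed.

Let S2_Lr : Lr_bounded P r S2 (k2 * ((1 + delta1) * b0 * psi)).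
Proof.
have d1b0 : 0 <= (1 + delta1) * b0 by rewrite mulr_ge0// addr_ge0.
apply: (martingale_Lr_bounded (Y := fun i w => Xt (t i) w * Q (t i) (W (t i) w))
  Kr0 HKr (mulr_ge0 d1b0 psi0)) => i ni;
  have ti := tT ni.
  apply/(F_measurable _ ni); apply: measurable_funM.
    have -> : Xt (t i) = X (t i) \+ (fun w => delta1 * pX (t i) (X (t i) w)).
      by apply/funext => w; rewrite XtE.
    apply: measurable_funD; first exact: X_adapted.
    apply: measurable_funM => //; exact: (measurableT_comp (mpX ti) (X_adapted ni)).
  exact: (measurableT_comp (mQ ti) (W_adapted ni)).
have mX := adapted_measurable filF (t0 ni) (progressive_adapted filF X_prog ti).
have mW := wiener_measurable filF wW (t0 ni).
apply: (Lr_bounded_le r1 (g := fun w => (1 + delta1) * b0 * Psi (t i) w)) => [|w|]; first last.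
- by have := Lr_boundedZ d1b0 (HPsi ti).
- rewrite normrM [leRHS]ger0_norm; last by rewrite mulr_ge0 ?Psi_ge0.
  apply: (le_trans (ler_pM _ _ (Xt_le w ti) (Q_le (W (t i) w) ti))) => //.
  by rewrite /Psi le_eqVlt; apply/orP; left; apply/eqP; ring.
  apply: measurable_funM.
    have -> : Xt (t i) = X (t i) \+ (fun w => delta1 * pX (t i) (X (t i) w)).
      by apply/funext => w; rewrite XtE.
    apply: measurable_funD => //.
    apply: measurable_funM => //; exact: (measurableT_comp (mpX ti) mX).
  exact: (measurableT_comp (mQ ti) mW).
Qed.

Let A_Lr : Lr_bounded P r (fun w => I w - A w) (k1 * (L * mesh)).
Proof.
have mesh0 : 0 <= mesh by exact: bigmax_ge_id.
have KT0 : 0 <= 2 `^ r * (Kr * T) by rewrite !mulr_ge0 ?powR_ge0// ltW.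
split.
- apply: measurable_funB; first by case: HI.
  apply: (weighted_sum_measurable (Y := fun i => X (t i)) filF wW tP) => i ni.
  exact: (X_measurable filF X_prog (tT ni)).
- by rewrite mulr_ge0 ?powR_ge0// mulr_ge0.
have := ito_quadrature_error filF wW T0 r2 rho0 L0 X_prog integrand_class_holder
  K20 HK2 HKr HI tP mesh_le.
move=> /le_trans; apply; rewrite lee_fin [leRHS]powRM ?powR_ge0 ?mulr_ge0//.
rewrite -powRrM mulVf ?gt_eqF// powRr1// le_eqVlt; apply/orP; left.
by apply/eqP; ring.
Qed.

Let error_le w : `|I w - rm_quadrature n t Xt Wt w| <=
  `|I w - A w| + delta1 * `|S1 w| + delta2 * `|S2 w| +
  delta2 * ((1 + delta1) * 2 `^ s) * remainder w.
Proof.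
(* [rem i] is what the first-order term [Q dW] leaves of the disturbance increment; that term moves
   into [S2], whose weights are known at the left endpoint. *)
pose rem i := pW (t i.+1) (W (t i.+1) w) - pW (t i) (W (t i) w) -
  Q (t i) (W (t i) w) * dW i w.
have rmE : rm_quadrature n t Xt Wt w = A w + delta1 * S1 w + delta2 * S2 w +
    delta2 * \sum_(i < n) Xt (t i) w * rem i.
  rewrite /rm_quadrature /A /S1 /S2 !mulr_sumr -!big_split/=.
  apply: eq_bigr => i _; rewrite !WtE ?tST ?tT// /rem XtE ?tT//; ring.
have remainderE : `|\sum_(i < n) Xt (t i) w * rem i| <=
    (1 + delta1) * 2 `^ s * remainder w.
  rewrite (le_trans (ler_norm_sum _ _ _))// /remainder mulr_sumr.
  apply: ler_sum => i _; have ni := ltn_ord i.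
  have /andP[_ tS] := tST ni.
  have h := pW_le (W (t i) w) (W (t i.+1) w) (t0 ni) (t_lt ni) tS.
  rewrite normrM (le_trans (ler_pM _ _ (Xt_le w (tT ni)) h))//.
  by rewrite /Psi /g le_eqVlt; apply/orP; left; apply/eqP; ring.
have := ler_wpM2l d20 remainderE; rewrite -{1}(ger0_norm d20) -normrM => h.
rewrite rmE.
have -> : I w - (A w + delta1 * S1 w + delta2 * S2 w +
    delta2 * (\sum_(i < n) Xt (t i) w * rem i)) =
  (I w - A w) - delta1 * S1 w - delta2 * S2 w -
    delta2 * (\sum_(i < n) Xt (t i) w * rem i) by ring.
rewrite (le_trans (ler_normB _ _))// -mulrA lerD//.
rewrite (le_trans (ler_normB _ _))// lerD//; last by rewrite normrM ger0_norm.
by rewrite (le_trans (ler_normB _ _))// lerD// normrM ger0_norm.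
Qed.

Lemma rm_quadrature_error :
  ('N[P]_(r%:E)[(fun w => (I w - rm_quadrature n t Xt Wt w)%:E)] <=
   (k1 * (L * mesh) + delta1 * (k2 * psi) +
    delta2 * (k2 * ((1 + delta1) * b0 * psi)) +
    delta2 * ((1 + delta1) * 2 `^ s) *
    \sum_(i < n) psi * (c * (dt i `^ a + dt i `^ (m / 2))))%:E)%E.
Proof.
apply: (Lnorm_le_Lr_bounded r1 error_le).
have c1 : 0 <= delta2 * ((1 + delta1) * 2 `^ s).
  by rewrite !mulr_ge0 ?addr_ge0 ?powR_ge0.
apply: (Lr_boundedD r1 _ (Lr_boundedZ c1 remainder_Lr_bounded)).
apply: (Lr_boundedD r1 _ (Lr_boundedZ d20 (Lr_bounded_normr r1 S2_Lr))).
apply: (Lr_boundedD r1 _ (Lr_boundedZ d10 (Lr_bounded_normr r1 S1_Lr))).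
by have := Lr_bounded_normr r1 A_Lr.
Qed.
End error_decomposition.

Lemma Lr_bounded_weight_cases (R : realType) (r q L T s : R) :
  1 <= r -> 0 <= L -> 0 < T -> 0 <= s -> r < q \/ s = 0 /\ r <= q ->
  exists2 b, 0 < b & forall d (Omega : measurableType d)
    (P : probability Omega R) (F : R -> set (set Omega)) (W : R -> Omega -> R),
  filtration F -> wiener_process P F W -> forall t, 0 <= t <= T ->
  forall Z : Omega -> R, measurable_fun setT Z ->
  (\int[P]_w (`|Z w| `^ q)%:E <= (L `^ q)%:E)%E ->
  Lr_bounded P r (fun w => (1 + `|Z w|) * (1 + `|W t w| `^ s)) b.
Proof.
move=> r1 L0 T0 s0 [rq|[-> rq]]; first exact: Lr_bounded_weight.
have [b b0 Hb] := Lr_bounded_weight0 r1 rq L0.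
by exists b => // d Omega P F W _ _ t _ Z; exact: Hb.
Qed.

(** The common form of the three cases. [b0] multiplies the first-order term, which is of order one
    in the grid; the sum comes from the remainder of orders a in time and m in space. *)
Lemma rm_quadrature_error_bound (R : realType) (rho r L T s q a m : R) :
  0 < rho -> 2 <= r -> 0 <= L -> 0 < T -> 0 <= s -> 0 <= a -> 0 < m ->
  r < q \/ s = 0 /\ r <= q ->
  exists2 K, 0 <= K & forall d (Omega : measurableType d)
    (P : probability Omega R) (F : R -> set (set Omega)) (W : R -> Omega -> R),
  filtration F -> wiener_process P F W ->
  forall (n : nat) (t : nat -> R), discretization T n t ->
  forall delta1 delta2 : R, 0 <= delta1 -> 0 <= delta2 ->
  forall X : R -> Omega -> R, integrand_class P F T rho r q L X ->
  forall (Xt Wt : R -> Omega -> R) (pW Q : R -> R -> R) (b0 : R),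
  noisy T (K1 T) X delta1 Xt ->
  (forall u w, 0 <= u <= T -> Wt u w = W u w + delta2 * pW u (W u w)) ->
  0 <= b0 ->
  (forall u, 0 <= u <= T -> measurable_fun setT (Q u)) ->
  (forall u y, 0 <= u <= T -> `|Q u y| <= b0 * (1 + `|y| `^ s)) ->
  (forall u v y z, 0 <= u -> u < v -> v <= T ->
    `|pW v z - pW u y - Q u y * (z - y)| <=
    growth s y (z - y) * ((v - u) `^ a + `|z - y| `^ m)) ->
  forall I : Omega -> R, ito_integral P F T W X I ->
  ('N[P]_(r%:E)[(fun w => (I w - rm_quadrature n t Xt Wt w)%:E)] <=
   (K * (mesh_pow n t rho + delta1 + delta2 * (1 + delta1) *
     (b0 + \sum_(i < n) ((t i.+1 - t i) `^ a + (t i.+1 - t i) `^ (m / 2)))))%:E)%E.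
Proof.
move=> rho0 r2 L0 T0 s0 a0 m0 sq.
have r1 : 1 <= r by apply: le_trans r2; rewrite ler1n.
have rq : r <= q by case: sq => [/ltW|[]].
have [K2 K20 HK2] := @wiener_sum_moment R 2 T (lexx _) T0.
have [Kr Kr0 HKr] := @wiener_sum_moment R r T r2 T0.
have [psi psi0 Hpsi] := Lr_bounded_weight_cases r1 L0 T0 s0 sq.
have [c c0 Hc] := wiener_incr_growth_moment r1 T0 s0 a0 m0.
pose k1 := (2 `^ r * (Kr * T)) `^ r^-1.
pose k2 := (Kr * T) `^ r^-1.
have k10 : 0 <= k1 by exact: powR_ge0.
have k20 : 0 <= k2 by exact: powR_ge0.
pose k3 := 2 `^ s * (psi * c).
have k30 : 0 <= k3 by rewrite !mulr_ge0 ?powR_ge0// ltW.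
have kL0 : 0 <= k1 * L by exact: mulr_ge0.
have kp0 : 0 <= k2 * psi by rewrite mulr_ge0// ltW.
exists (k1 * L + k2 * psi + k3) => [|d Omega P F W filF wW n t tP d1 d2 d10 d20
  X XF Xt Wt pW Q b0 [pX pXK XtE] WtE b00 mQ Q_le pW_le I HI].
  by rewrite !addr_ge0.
have X_prog : progressively_measurable F T X by case: XF.
have HPsi u (uT : 0 <= u <= T) := Hpsi _ _ P F W filF wW u uT (X u)
  (X_measurable filF X_prog uT) (integrand_class_moment r2 rq L0 XF uT).
have {}pW_le u v y z : 0 <= u -> u < v -> v <= T ->
    `|pW v z - pW u y - Q u y * (z - y)| <= 2 `^ s * ((1 + `|y| `^ s) *
    ((1 + `|z - y| `^ s) * ((v - u) `^ a + `|z - y| `^ m))).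
  by move=> u0 uv vT; have := pW_le u v y z u0 uv vT; rewrite /growth -!mulrA.
have := rm_quadrature_error filF wW T0 r2 rho0 L0 XF tP (ltW psi0) HPsi
  (ltW c0) (Hc _ _ P F W filF wW) d10 d20 pXK XtE WtE b00 mQ Q_le pW_le (ltW K20)
  (ltW Kr0) (HK2 _ _ P F W filF wW) (HKr _ _ P F W filF wW) HI.
move=> /le_trans; apply; rewrite lee_fin.
set S := (X in _ <= _ * (_ + _ * (b0 + X))).
have -> : \sum_(i < n) psi * (c * ((t i.+1 - t i) `^ a + (t i.+1 - t i) `^ (m / 2)))
    = psi * c * S by rewrite mulr_sumr; apply: eq_bigr => i _; rewrite mulrA.
rewrite -/k1 -/k2; set M := mesh_pow n t rho.
have M0 : 0 <= M by exact: bigmax_ge_id.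
have S0 : 0 <= S by apply: sumr_ge0 => i _; rewrite addr_ge0 ?powR_ge0.
set e := d2 * (1 + d1); have e0 : 0 <= e by rewrite mulr_ge0 ?addr_ge0.
have -> : k1 * (L * M) + d1 * (k2 * psi) + d2 * (k2 * ((1 + d1) * b0 * psi)) +
    d2 * ((1 + d1) * 2 `^ s) * (psi * c * S) =
    k1 * L * M + k2 * psi * d1 + k2 * psi * (e * b0) + k3 * (e * S).
  by rewrite /k3 /e; ring.
move: kL0 kp0 k30; set kL := k1 * L; set kp := k2 * psi => kL0 kp0 k30.
have eb0 : 0 <= e * b0 by exact: mulr_ge0.
have eS0 : 0 <= e * S by exact: mulr_ge0.
rewrite (mulrDr e).
have := mulr_ge0 kp0 M0; have := mulr_ge0 k30 M0.
have := mulr_ge0 kL0 d10; have := mulr_ge0 k30 d10.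
have := mulr_ge0 kL0 eb0; have := mulr_ge0 k30 eb0.
have := mulr_ge0 kL0 eS0; have := mulr_ge0 kp0 eS0.
lra.
Qed.

(** * The three classes of disturbances of the Wiener process *)

Unset Implicit Arguments.

Theorem theorem1 (R : realType) (rho r L T : R)
    (hrho : 0 < rho <= 1) (hr : 2 <= r) (hL : 0 <= L) (hT : 0 < T) :
  [/\
    (forall s q : R, 0 <= s -> r < q ->
      exists C : R, 0 < C /\
      forall (d : measure_display) (Omega : measurableType d)
        (P : probability Omega R) (F : R -> set (set Omega))
        (W : R -> Omega -> R),
      measure_is_complete P -> filtration F -> usual_conditions P F ->
      wiener_process P F W ->
      forall (n : nat) (t : nat -> R), discretization T n t ->
      forall delta1 delta2 : R, 0 <= delta1 -> 0 <= delta2 ->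
      forall X : R -> Omega -> R, integrand_class P F T rho r q L X ->
      forall Xt Wt : R -> Omega -> R,
      noisy T (K1 T) X delta1 Xt -> noisy T (K2 T s) W delta2 Wt ->
      forall IXW : Omega -> R, ito_integral P F T W X IXW ->
      ('N[P]_(r%:E)[(fun w => (IXW w - rm_quadrature n t Xt Wt w)%:E)] <=
       (C * (mesh_pow n t rho + delta1 + delta2 + delta1 * delta2))%:E)%E),
    (forall s q : R, 0 <= s -> r < q ->
      exists C : R, 0 < C /\
      forall (d : measure_display) (Omega : measurableType d)
        (P : probability Omega R) (F : R -> set (set Omega))
        (W : R -> Omega -> R),
      measure_is_complete P -> filtration F -> usual_conditions P F ->
      wiener_process P F W ->
      forall (n : nat) (t : nat -> R), discretization T n t ->
      forall delta1 delta2 : R, 0 <= delta1 -> 0 <= delta2 ->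
      forall X : R -> Omega -> R, integrand_class P F T rho r q L X ->
      forall Xt Wt : R -> Omega -> R,
      noisy T (K1 T) X delta1 Xt -> noisy T (K2bar T s) W delta2 Wt ->
      forall IXW : Omega -> R, ito_integral P F T W X IXW ->
      ('N[P]_(r%:E)[(fun w => (IXW w - rm_quadrature n t Xt Wt w)%:E)] <=
       (C * (mesh_pow n t rho + delta1 + delta2 * (1 + delta1) *
         (1 + \sum_(i < n) (t i.+1 - t i) `^ 2^-1)))%:E)%E)
  & (forall alpha beta q : R, 0 < alpha <= 1 -> 0 < beta <= 1 -> r <= q ->
      exists C : R, 0 < C /\
      forall (d : measure_display) (Omega : measurableType d)
        (P : probability Omega R) (F : R -> set (set Omega))
        (W : R -> Omega -> R),
      measure_is_complete P -> filtration F -> usual_conditions P F ->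
      wiener_process P F W ->
      forall (n : nat) (t : nat -> R), discretization T n t ->
      forall delta1 delta2 : R, 0 <= delta1 -> 0 <= delta2 ->
      forall X : R -> Omega -> R, integrand_class P F T rho r q L X ->
      forall Xt Wt : R -> Omega -> R,
      noisy T (K1 T) X delta1 Xt -> noisy T (K3 T alpha beta) W delta2 Wt ->
      forall IXW : Omega -> R, ito_integral P F T W X IXW ->
      ('N[P]_(r%:E)[(fun w => (IXW w - rm_quadrature n t Xt Wt w)%:E)] <=
       (C * (mesh_pow n t rho + delta1 + delta2 * (1 + delta1) *
         \sum_(i < n) ((t i.+1 - t i) `^ alpha +
                       (t i.+1 - t i) `^ (beta / 2))))%:E)%E)].
Proof.
have [rho0 _] := andP hrho.
have t_sub n t i : discretization T n t -> (i < n)%N -> 0 <= t i.+1 - t i.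
  by move=> [_ _ tS] ni; rewrite subr_ge0 ltW// tS.
split.
- move=> s q s0 rq.
  have [K K0 HK] := @rm_quadrature_error_bound R rho r L T s q 1 2 rho0 hr hL hT s0
    ler01 (ltr0Sn _ 1) (or_introl rq).
  (* With a = 1 and m / 2 = 1 both sums equal T, and [b0] = 1, so the bracket is 1 + 2 T; delta2 (1
     + delta1) expands to delta2 + delta1 delta2. *)
  exists (K * (1 + 2 * T) + 1); split.
    by rewrite ltr_wpDl// mulr_ge0// addr_ge0// mulr_ge0// ltW.
  move=> d Omega P F W _ filF _ wW n t tP delta1 delta2 d10 d20 X XF Xt Wt XtK
    [p pK WtE] I HI.
  have [py [mpy py_le p_le]] := K2_increment s0 pK.
  have := HK d Omega P F W filF wW n t tP delta1 delta2 d10 d20 X XF Xt Wt p py 1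
    XtK WtE ler01 mpy _ _ I HI.
  move=> /(_ _ _)/le_trans; apply.
  + by move=> u y uT; rewrite mul1r; exact: py_le.
  + move=> u v y z u0 uv vT; rewrite powRr1 ?subr_ge0 ?(ltW uv)// powR_mulrn//.
    rewrite real_normK ?num_real// -[v - u]ger0_norm ?subr_ge0 ?(ltW uv)//.
    have uT : 0 <= u <= T by rewrite u0 (le_trans (ltW uv)).
    have vT' : 0 <= v <= T by rewrite vT (le_trans u0 (ltW uv)).
    exact: p_le.
  rewrite lee_fin.
  have -> : \sum_(i < n) ((t i.+1 - t i) `^ 1 + (t i.+1 - t i) `^ (2 / 2)) = 2 * T.
    rewrite -(discretization_sum tP) mulr_sumr; apply: eq_bigr => i _.
    by rewrite divff// powRr1 ?(t_sub n)//; ring.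
  set M := mesh_pow n t rho; have M0 : 0 <= M by exact: bigmax_ge_id.
  have e0 : 0 <= delta1 * delta2 by exact: mulr_ge0.
  have := mulr_ge0 (mulr_ge0 K0 (ltW hT)) M0.
  have := mulr_ge0 (mulr_ge0 K0 (ltW hT)) d10.
  lra.
- move=> s q s0 rq.
  have [K K0 HK] := @rm_quadrature_error_bound R rho r L T s q 1 1 rho0 hr hL hT s0
    ler01 ltr01 (or_introl rq).
  (* The time part sums to T and is absorbed by the 1 in the bracket. The whole space increment is
     treated as remainder, with [Q] = 0 and m = 1, which leaves the sum of the square roots. *)
  exists (K * (1 + T) + 1); split.
    by rewrite ltr_wpDl// mulr_ge0// addr_ge0// ltW.
  move=> d Omega P F W _ filF _ wW n t tP delta1 delta2 d10 d20 X XF Xt Wt XtK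
    [p pK WtE] I HI.
  have := HK d Omega P F W filF wW n t tP delta1 delta2 d10 d20 X XF Xt Wt p
    (fun _ _ => 0) 0 XtK WtE (lexx _) _ _ _ I HI.
  move=> /(_ _ _ _)/le_trans; apply.
  + by move=> u _; exact: measurable_cst.
  + by move=> u y _; rewrite normr0 mul0r.
  + move=> u v y z u0 uv vT; rewrite !powRr1 ?subr_ge0 ?(ltW uv)//.
    rewrite mul0r subr0 -[v - u]ger0_norm ?subr_ge0 ?(ltW uv)//.
    have uT : 0 <= u <= T by rewrite u0 (le_trans (ltW uv)).
    have vT' : 0 <= v <= T by rewrite vT (le_trans u0 (ltW uv)).
    exact: (@K2bar_increment R T s p u v y z s0 pK uT vT').
  rewrite lee_fin add0r big_split/=.
  have -> : \sum_(i < n) (t i.+1 - t i) `^ 1 = T.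
    rewrite -[RHS](discretization_sum tP); apply: eq_bigr => i _.
    by rewrite powRr1// (t_sub n).
  rewrite div1r; set S := \sum_(i < n) _.
  have S0 : 0 <= S by apply: sumr_ge0 => i _; exact: powR_ge0.
  set M := mesh_pow n t rho; have M0 : 0 <= M by exact: bigmax_ge_id.
  have e0 : 0 <= delta2 * (1 + delta1) by rewrite mulr_ge0// addr_ge0.
  set e := delta2 * (1 + delta1) in e0 *.
  have KT0 := mulr_ge0 K0 (ltW hT).
  have := mulr_ge0 KT0 M0; have := mulr_ge0 KT0 d10.
  have := mulr_ge0 KT0 (mulr_ge0 e0 S0); have := mulr_ge0 e0 S0.
  have := mulr_ge0 K0 e0.
  lra.
- move=> alpha beta q /andP[al0 _] /andP[be0 _] rq.
  have [K K0 HK] := @rm_quadrature_error_bound R rho r L T 0 q alpha beta rho0 hr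
    hL hT (lexx _) (ltW al0) be0 (or_intror (conj erefl rq)).
  exists (K + 1); split; first by rewrite ltr_wpDl.
  move=> d Omega P F W _ filF _ wW n t tP delta1 delta2 d10 d20 X XF Xt Wt XtK
    [p pK WtE] I HI.
  have := HK d Omega P F W filF wW n t tP delta1 delta2 d10 d20 X XF Xt Wt p
    (fun _ _ => 0) 0 XtK WtE (lexx _) _ _ _ I HI.
  move=> /(_ _ _ _)/le_trans; apply.
  + by move=> u _; exact: measurable_cst.
  + by move=> u y _; rewrite normr0 mul0r.
  + move=> u v y z u0 uv vT; rewrite mul0r subr0 -{1}[v - u]ger0_norm; last first.
      by rewrite subr_ge0 ltW.
    have := pK v u z y; rewrite vT u0 (le_trans u0 (ltW uv)) (le_trans (ltW uv) vT).
    move=> /(_ isT isT)/le_trans; apply.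
    (* For s = 0, [growth] is the constant 4, so it only enlarges the Holder modulus. *)
    by rewrite /growth !powRr0 mul1r ler_peMl ?addr_ge0 ?powR_ge0//; lra.
  rewrite lee_fin add0r; set S := \sum_(i < n) _.
  have S0 : 0 <= S by apply: sumr_ge0 => i _; rewrite addr_ge0 ?powR_ge0.
  have M0 : 0 <= mesh_pow n t rho by exact: bigmax_ge_id.
  by rewrite ler_wpM2r ?lerDl// !addr_ge0 ?mulr_ge0 ?addr_ge0.
Qed.
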